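(* Let $\tau$ be a regular tetrahedron in $\mathbb{R}^3$. Then the iterated median subdivisions $Med_{(n)}(\tau)$, $n\ge 1$, are $\varphi$-fat triangulations with a fixed fatness coefficient $\varphi>0$ for all $n$.
   Context: Fatness: a triangle in $\mathbb{R}^2$ is $\varphi$-fat if all its angles are larger than $\varphi>0$; a $k$-simplex is $\varphi$-fat if $r/R\ge\varphi$, where $r,R$ are the radii of its inscribed and circumscribed $(k-1)$-spheres; a triangulation is $\varphi$-fat if all its simplices are. A tetrahedron is almost regular if it has five edges of equal length and its sixth edge is $\sqrt2$ times longer. A triangulation is almost regular if each of its tetrahedra is regular or almost regular. Median subdivision $Med(\tau)$ of a tetrahedron $\tau$ that is regular or almost regular: add the midpoints of the six edges, in each $2$-face join the three midpoints pairwise by edges, and for each vertex of $\tau$ add the planar triangle spanned by the midpoints of the three edges at that vertex. This cuts $\tau$ into four corner tetrahedra and one octahedron whose vertices are the six midpoints. The octahedron contains three planar quadrilaterals, each spanned by the four midpoints other than those of a pair of opposite edges of $\tau$. If $\tau$ is regular, add any two of these quadrilaterals (squares), cutting the octahedron into four tetrahedra. If $\tau$ is almost regular with long edge $L$, add the two quadrilaterals (rhombi) that contain both the midpoint $e$ of $L$ and the midpoint $f$ of the edge opposite to $L$, cutting the octahedron into four tetrahedra sharing the edge $ef$. The result is the simplicial complex $Med(\tau)$. For an almost regular triangulation, $Med$ is applied to every tetrahedron. The iterates are $Med_{(1)}(\tau)=Med(\tau)$ and $Med_{(n)}(\tau)=Med(Med_{(n-1)}(\tau))$. *)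

(* Defs.v *)
From mathcomp Require Import all_boot all_order all_algebra finmap.
From mathcomp Require Import boolp classical_sets cardinality reals trigo.
Set Implicit Arguments.
Unset Strict Implicit.
Unset Printing Implicit Defensive.
Import Order.TTheory GRing.Theory Num.Theory.

Local Open Scope classical_set_scope.
Local Open Scope fset_scope.
Local Open Scope ring_scope.

Notation point R := 'rV[R]_3.

(* A simplex is the finite set of its vertices, and a complex is the set of
   its simplices. *)
Notation simplex R := {fset 'rV[R]_3}.
Notation complex R := (set {fset 'rV[R]_3}).

Section Geometry.
Variable R : realType.
Implicit Types (p q r x y : point R) (s t : simplex R) (K : complex R).

(* MathComp-Analysis norms 'rV[R]_3 by the maximum of the coordinates, so the
   Euclidean structure is defined here. *)
Definition dot x y : R := \sum_(i < 3) x 0 i * y 0 i.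
Definition edist x y : R := Num.sqrt (dot (x - y) (x - y)).

Definition angle p q r : R :=
  acos (dot (q - p) (r - p) / (edist q p * edist r p)).

Definition midpoint x y : point R := 2^-1 *: (x + y).

Definition aff s : set (point R) :=
  [set x | exists w : point R -> R,
    \sum_(v <- s) w v = 1 /\ x = \sum_(v <- s) w v *: v].

Definition conv s : set (point R) :=
  [set x | exists w : point R -> R,
    [/\ {in s, forall v, 0 <= w v}, \sum_(v <- s) w v = 1
      & x = \sum_(v <- s) w v *: v]].

Definition affinely_independent s : Prop :=
  forall w : point R -> R,
    \sum_(v <- s) w v = 0 -> \sum_(v <- s) w v *: v = 0 ->
    {in s, forall v, w v = 0}.

(* The last clause says that the geometric simplices s and t are disjoint or
   meet in a common face; conv fset0 is empty. *)
Definition simplicial_complex K : Prop :=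
  [/\ forall s, K s -> s != fset0 /\ affinely_independent s,
      forall s t, K s -> t != fset0 -> t `<=` s -> K t
    & forall s t, K s -> K t -> exists u,
        [/\ u `<=` s, u `<=` t & (conv s `&` conv t)%classic = conv u]].

Definition underlying_space K : set (point R) :=
  (\bigcup_(s in K) conv s)%classic.

Definition triangulation (A : set (point R)) K : Prop :=
  [/\ simplicial_complex K, finite_set K & underlying_space K = A].

Definition circumscribed_sphere s (c : point R) (rho : R) : Prop :=
  aff s c /\ {in s, forall v, edist c v = rho}.

(* The sphere of centre c and radius rho in aff s bounds a ball contained in
   the simplex and touches each of its facets. *)
Definition inscribed_sphere s (c : point R) (rho : R) : Prop :=
  [/\ aff s c, 0 < rho,
      (forall x, aff s x -> edist c x <= rho -> conv s x)
    & {in s, forall v, exists x, conv (s `\ v) x /\ edist c x = rho}].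

Definition fat_ratio (phi : R) s : Prop :=
  exists c rin d Rout,
    [/\ inscribed_sphere s c rin, circumscribed_sphere s d Rout
      & phi <= rin / Rout].

Definition fat_angles (phi : R) s : Prop :=
  forall p q r, s = [fset p; q; r] -> phi < angle p q r.

(* A triangle has to satisfy both notions of fatness.  A vertex has neither an
   inscribed nor a circumscribed sphere, and is not constrained. *)
Definition fat_simplex (phi : R) s : Prop :=
  ((1 < #|` s|)%N -> fat_ratio phi s) /\ (#|` s| = 3%N -> fat_angles phi s).

Definition fat (phi : R) K : Prop := forall s, K s -> fat_simplex phi s.

Definition tetrahedron t : Prop := #|` t| = 4%N /\ affinely_independent t.

Definition regular t : Prop :=
  tetrahedron t /\
  exists l : R, {in t &, forall x y, x != y -> edist x y = l}.

(* almost_regular t a b c d: the tetrahedron t = abcd is almost regular with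
   long edge ab, whose opposite edge is cd. *)
Definition almost_regular t a b c d : Prop :=
  [/\ tetrahedron t, t = [fset a; b; c; d]
    & exists l : R, edist a b = Num.sqrt 2 * l /\
        [/\ edist a c = l, edist a d = l, edist b c = l, edist b d = l
          & edist c d = l]].

(* q is the vertex set of the quadrilateral spanned by the midpoints of the
   edges of t other than those of a pair ab, cd of opposite edges. *)
Definition quadrilateral t (q : simplex R) : Prop :=
  exists a b c d, t = [fset a; b; c; d] /\
    q = [fset midpoint a c; midpoint a d; midpoint b c; midpoint b d].

(* The pairs of quadrilaterals that may be added inside the octahedron of t
   when t is regular or almost regular.  The second clause is void when t is
   regular. *)
Definition admissible t (Q : simplex R * simplex R) : Prop :=
  [/\ quadrilateral t Q.1, quadrilateral t Q.2, Q.1 != Q.2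
    & forall a b c d, almost_regular t a b c d ->
        [/\ midpoint a b \in Q.1, midpoint a b \in Q.2,
            midpoint c d \in Q.1 & midpoint c d \in Q.2]].

Definition quad_choice := simplex R -> simplex R * simplex R.

Definition admissible_choice (f : quad_choice) : Prop :=
  forall t, regular t \/ (exists a b c d, almost_regular t a b c d) ->
    admissible t (f t).

Definition corner t u : Prop :=
  exists2 v, v \in t & u = v |` [fset midpoint v w | w in t `\ v].

(* Two of the quadrilaterals of t meet in a diagonal of the octahedron, and
   each has two further vertices.  Adding both cuts the octahedron into the
   four tetrahedra spanned by that diagonal, a further vertex of the first and
   a further vertex of the second. *)
Definition octahedron_piece (Q : simplex R * simplex R) u : Prop :=
  exists x y, [/\ x \in Q.1 `\` Q.2, y \in Q.2 `\` Q.1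
                & u = (Q.1 `&` Q.2) `|` [fset x; y]].

Definition faces t : complex R := [set s | s != fset0 /\ (s `<=` t)%fset]%classic.

(* For t regular or almost regular: Med(t), with the quadrilaterals Q. *)
Definition Med_tetrahedron (Q : simplex R * simplex R) t : complex R :=
  (\bigcup_(u in [set u | corner t u \/ octahedron_piece Q u]) faces u)%classic.

Definition Med (f : quad_choice) K : complex R :=
  (\bigcup_(t in [set t | K t /\ #|` t| = 4%N]) Med_tetrahedron (f t) t)%classic.

(* f n is the choice of quadrilaterals made in passing from Med_(n) to
   Med_(n+1); Med_(0) consists of the tetrahedron and its faces. *)
Fixpoint Med_iter (f : nat -> quad_choice) (n : nat) t : complex R :=
  if n is m.+1 then Med (f m) (Med_iter f m t) else faces t.

End Geometry.

(* Main.v *)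
(* The corners of a tetrahedron are homothetic to it.  The octahedron inside a
   regular tetrahedron is regular, and any two of its squares cut it into almost
   regular tetrahedra; the prescribed rhombi cut the octahedron inside an almost
   regular tetrahedron into two regular and two almost regular tetrahedra.  Hence
   every simplex of every iterate is a face of one of two tetrahedra up to
   similarity, and finitely many explicit computations give the fatness.

   Within one tetrahedron, the weights of a point at the ten vertices of the
   subdivision are determined by its barycentric coordinates, whichever piece
   contains it, so the pieces meet in common faces.  Two tetrahedra meet in a
   common face, on which both induce the same subdivision, since the
   quadrilaterals lie in the interior. *)
Require Import Defs.
From mathcomp Require Import all_boot all_order all_algebra finmap.
From mathcomp Require Import boolp classical_sets cardinality reals trigo.
From mathcomp Require Import ring lra.
Import Order.TTheory GRing.Theory Num.Theory.
Local Open Scope fset_scope.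
Local Open Scope ring_scope.

Set Implicit Arguments.
Unset Strict Implicit.
Unset Printing Implicit Defensive.

(** * Convex hulls *)

Section Convexity.
Variable R : realType.
Implicit Types (s t : {fset 'rV[R]_3}) (w : 'rV[R]_3 -> R) (x y v : 'rV[R]_3).

(** The choice of quadrilaterals is absorbed by a relabelling. Any two of the three quadrilaterals
    share a diagonal of the octahedron, so the vertices can be named [a], [b], [c], [d] with this
    diagonal joining the midpoints of [ab] and [cd], and one explicit list of eight pieces serves
    every choice. Shapes and incidences cannot be treated separately: a choice is guaranteed to be
    admissible only on regular and almost regular tetrahedra, admissibility makes the pieces fit
    together, and it also decides the shapes of the next generation. One induction therefore carries
    both. *)

Lemma big_fset_widen (V : nmodType) (F : 'rV[R]_3 -> V) s (l : seq 'rV[R]_3) :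
  uniq l -> {subset s <= l} -> (forall v, v \notin s -> F v = 0) ->
  \sum_(v <- s) F v = \sum_(v <- l) F v.
Proof.
move=> ul sl F0; rewrite (bigID (mem s)) /= [X in _ + X]big1 ?addr0; last first.
  by move=> v; apply: F0.
rewrite [RHS](bigID (mem s)) /= [X in _ = _ + X]big1 ?addr0; last first.
  by move=> v; apply: F0.
rewrite -big_filter -[RHS]big_filter; apply/perm_big/uniq_perm; rewrite ?filter_uniq ?fset_uniq //.
move=> v; rewrite !mem_filter /=; case vs: (v \in s) => //=.
by rewrite (sl v vs).
Qed.

Definition comb s w : 'rV[R]_3 := \sum_(v <- s) w v *: v.

(** Unlike in [conv], the function must vanish off [s], so that the weights of a point in two
    different simplices can be compared as functions on the whole space. *)
Definition weights s w : Prop :=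
  [/\ forall v, 0 <= w v, forall v, v \notin s -> w v = 0
    & \sum_(v <- s) w v = 1].

Lemma comb_widen s w (l : seq 'rV[R]_3) :
  uniq l -> {subset s <= l} -> (forall v, v \notin s -> w v = 0) ->
  comb s w = \sum_(v <- l) w v *: v.
Proof.
move=> ul sl w0; apply: big_fset_widen => // v /w0 ->; exact: scale0r.
Qed.

Lemma convP s x : conv s x <-> exists2 w, weights s w & x = comb s w.
Proof.
split=> [[w [w0 w1 ->]]|[w [w0 _ w1] ->]]; last by exists w; split=> // v _; apply: w0.
exists (fun v => if v \in s then w v else 0); last first.
  by apply: eq_big_seq => v /= ->.
split=> [v|v /negPf -> //|]; first by case: ifP => // /w0.
by rewrite -w1; apply: eq_big_seq => v /= ->.
Qed.

Lemma weights_sub s t w : (s `<=` t)%fset -> weights s w ->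
  weights t w /\ comb s w = comb t w.
Proof.
move=> /fsubsetP st [w0 wn w1]; split; last first.
  by apply: comb_widen => //; exact: fset_uniq.
split=> // [v vt|]; first by apply: wn; apply: contra vt => /st.
by rewrite -w1; symmetry; apply: big_fset_widen => //; exact: fset_uniq.
Qed.

Lemma conv_sub s t x : (s `<=` t)%fset -> conv s x -> conv t x.
Proof.
move=> st /convP[w sw ->]; apply/convP; exists w; by case: (weights_sub st sw).
Qed.

Lemma conv_aff s x : conv s x -> aff s x.
Proof. by case=> w [_ w1 ->]; exists w. Qed.

Lemma sum_indicator s v : v \in s -> \sum_(u <- s) (u == v)%:R = 1 :> R.
Proof.
move=> vs; rewrite (big_fsetD1 v) //= eqxx big_seq big1 ?addr0 // => u.
by rewrite !inE => /andP[/negPf ->].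
Qed.

Lemma comb_indicator s v : v \in s -> comb s (fun u => (u == v)%:R) = v.
Proof.
move=> vs; rewrite /comb (big_fsetD1 v) //= eqxx scale1r big_seq big1 ?addr0 // => u.
by rewrite !inE => /andP[/negPf ->]; rewrite scale0r.
Qed.

Lemma conv_vertex s v : v \in s -> conv s v.
Proof.
move=> vs; exists (fun u => (u == v)%:R); split=> [u _||].
- exact: ler0n.
- exact: sum_indicator.
- by rewrite -[LHS](comb_indicator vs).
Qed.

Lemma conv0 x : ~ conv (fset0 : {fset 'rV[R]_3}) x.
Proof.
case=> w [_ + _]; rewrite big_seq_fset0 => /eqP; by rewrite eq_sym oner_eq0.
Qed.

(* Two simplices in which every common point has the same weights, extended by
   0 to all points, meet in the simplex on their common vertices. *)
Lemma conv_cap s t :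
  (forall w w', weights s w -> weights t w' -> comb s w = comb t w' -> w =1 w') ->
  (conv s `&` conv t)%classic = conv (s `&` t)%fset.
Proof.
move=> U; apply/seteqP; split=> x /=; last first.
  by move=> h; split; apply: conv_sub h; rewrite ?fsubsetIl ?fsubsetIr.
case=> /convP[w ws xw] /convP[w' wt xw'].
have e : w =1 w' by apply: U => //; rewrite -xw.
case: ws => w0 wn w1; case: wt => w0' wn' w1'.
have wI v : v \notin s `&` t -> w v = 0.
  by rewrite inE negb_and => /orP[/wn//|/wn' ]; rewrite e.
have sub : {subset s `&` t <= s} by move=> v; rewrite inE => /andP[].
apply/convP; exists w.
  split=> //; rewrite -w1; exact: (@big_fset_widen _ _ _ _ (fset_uniq s)).
by rewrite (comb_widen (fset_uniq s) sub wI).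
Qed.

Lemma indep_weights t w w' : affinely_independent t ->
  \sum_(v <- t) w v = \sum_(v <- t) w' v -> comb t w = comb t w' ->
  {in t, w =1 w'}.
Proof.
move=> it e1 e2 v vt; apply/eqP; rewrite -subr_eq0; apply/eqP.
apply: (it (fun v => w v - w' v)) => //.
  by rewrite sumrB e1 subrr.
under eq_bigr do rewrite scalerBl.
by rewrite sumrB; apply/eqP; rewrite subr_eq0; apply/eqP.
Qed.

Lemma indep_uniq t s s' w w' : affinely_independent t ->
  (s `<=` t)%fset -> (s' `<=` t)%fset ->
  weights s w -> weights s' w' -> comb s w = comb s' w' -> w =1 w'.
Proof.
move=> it st st' /(weights_sub st)[wt ->] /(weights_sub st')[wt' ->] e v.
case: wt wt' => _ wn w1 [_ wn' w1'].
have [vt|vt] := boolP (v \in t); last by rewrite wn // wn'.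
by apply: (indep_weights it) e _ vt; rewrite w1.
Qed.

Lemma indep_sub s t : (s `<=` t)%fset -> affinely_independent t ->
  affinely_independent s.
Proof.
move=> /fsubsetP st it w e1 e2 v vs.
pose w' v := if v \in s then w v else 0.
have wn u : u \notin s -> w' u = 0 by rewrite /w' => /negPf ->.
have ww' : {in s, w =1 w'} by move=> u us; rewrite /w' us.
rewrite ww' //; apply: it; last exact: st.
  rewrite -(big_fset_widen (fset_uniq t) st wn) -[RHS]e1.
  by apply: eq_big_seq => u us; rewrite ww'.
rewrite -(comb_widen (fset_uniq t) st wn) -[RHS]e2.
by apply: eq_big_seq => u us; rewrite ww'.
Qed.

Lemma conv_trans s t w : {in s, forall v, conv t v} -> weights s w ->
  exists W : 'rV[R]_3 -> 'rV[R]_3 -> R,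
    [/\ {in s, forall v, weights t (W v) /\ v = comb t (W v)},
        weights t (fun b => \sum_(v <- s) w v * W v b)
      & comb s w = comb t (fun b => \sum_(v <- s) w v * W v b)].
Proof.
move=> sub [w0 wn w1].
have /choice[W WP] v : exists w', v \in s -> weights t w' /\ v = comb t w'.
  have [vs|_] := boolP (v \in s); last by exists (fun=> 0).
  by case/convP: (sub _ vs) => w' *; exists w'.
exists W; split; first exact: WP.
- split=> [b|b bt|].
  + rewrite big_seq; apply: sumr_ge0 => v vs; rewrite mulr_ge0 //.
    by case: (WP _ vs) => -[].
  + rewrite big_seq big1 // => v vs; case: (WP _ vs) => -[_ Wn _] _.
    by rewrite Wn // mulr0.
  + rewrite exchange_big -[RHS]w1; apply: eq_big_seq => v vs.
    by rewrite -mulr_sumr; case: (WP _ vs) => -[_ _ ->] _; rewrite mulr1.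
- rewrite /comb; under [RHS]eq_bigr do rewrite scaler_suml.
  rewrite exchange_big; apply: eq_big_seq => v vs.
  have [_ ev] := WP v vs; transitivity (w v *: comb t (W v)); first by rewrite -ev.
  rewrite /comb scaler_sumr.
  by apply: eq_bigr => b _; rewrite scalerA.
Qed.

Lemma conv_conv s t x : {in s, forall v, conv t v} -> conv s x -> conv t x.
Proof.
move=> st /convP[w ws ->]; have [W [_ Wt ->]] := conv_trans st ws.
by apply/convP; eexists; first exact: Wt.
Qed.

(** A face is extreme. At a vertex of [t] outside [u] the coordinate of the point is 0 and is a sum
    of nonnegative terms, so every [v] with [w v != 0] has coordinate 0 there as well and lies in
    [u]. *)
Lemma conv_face t u s x : affinely_independent t -> (u `<=` t)%fset ->
  {in s, forall v, conv t v} -> conv s x -> conv u x ->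
  conv [fset v in s | `[< conv u v >]] x.
Proof.
move=> it ut st /convP[w ws ->]; have [W [WP Wt e]] := conv_trans st ws.
rewrite {1}e => /convP[w' wu' e'].
have E := indep_uniq it (fsubset_refl t) ut Wt wu' e'.
case: ws => w0 wn w1; case: wu' => _ wn' _.
have sub : {subset [fset v in s | `[< conv u v >]] <= s}.
  by move=> v; rewrite !inE => /andP[].
have z v : v \notin [fset v in s | `[< conv u v >]] -> w v = 0.
  rewrite !inE negb_and => /orP[/wn //|].
  have [vs|/wn ->//] := boolP (v \in s).
  move=> /asboolPn nc; apply/eqP/negP => /negP wv0; apply: nc.
  have [Wv ev] := WP v vs; case: (Wv) => W0 Wn W1.
  have zb b : b \notin u -> W v b = 0.
    move=> /wn'; rewrite -E => /eqP; rewrite big_seq psumr_eq0; last first.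
      by move=> c cs; rewrite mulr_ge0 //; case: (WP _ cs) => -[].
    move=> /allP /(_ _ vs); rewrite vs /= mulf_eq0 (negPf wv0) => /eqP //.
  have sut : {subset u <= t} by apply/fsubsetP.
  rewrite ev (comb_widen (fset_uniq t) (fun _ h => h) Wn).
  rewrite -(comb_widen (fset_uniq t) sut zb).
  apply/convP; exists (W v) => //; split=> //.
  by rewrite -W1; apply: big_fset_widen => //; exact: fset_uniq.
apply/convP; exists w; last by rewrite (comb_widen (fset_uniq s) sub z).
by split=> //; rewrite -w1; exact: (@big_fset_widen _ _ _ _ (fset_uniq s)).
Qed.

Lemma midpointC x y : midpoint x y = midpoint y x.
Proof. by rewrite /midpoint addrC. Qed.

Lemma midpointxx x : midpoint x x = x.
Proof. by rewrite /midpoint -mulr2n -scaler_nat scalerA mulVf ?scale1r ?pnatr_eq0. Qed.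

(** As a sum of two indicators the formula also covers [x = y], where it gives weight 1. This case
    occurs: the apex [v] of a corner is treated as [midpoint v v]. *)
Lemma comb_midpoint t x y : x \in t -> y \in t ->
  weights t (fun v => 2^-1 * ((v == x)%:R + (v == y)%:R)) /\
  midpoint x y = comb t (fun v => 2^-1 * ((v == x)%:R + (v == y)%:R)).
Proof.
move=> xt yt; split; last first.
  rewrite /comb; under eq_bigr do rewrite -scalerA scalerDl.
  by rewrite -scaler_sumr big_split -!/(comb _ _) !comb_indicator.
split=> [v|v|]; first by rewrite mulr_ge0 ?invr_ge0 ?addr_ge0 ?ler0n.
- have ne z : z \in t -> v \notin t -> (v == z) = false.
    by move=> zt; apply: contraNF => /eqP ->.
  by move=> vt; rewrite !ne // addr0 mulr0.
- by rewrite -mulr_sumr big_split /= !sum_indicator //; lra.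
Qed.

Lemma midpoint_conv t x y : x \in t -> y \in t -> conv t (midpoint x y).
Proof.
by move=> xt yt; apply/convP; case: (comb_midpoint xt yt) => ? ?; eexists; eassumption.
Qed.

Lemma midpoint_face t u x y : affinely_independent t -> (u `<=` t)%fset ->
  x \in t -> y \in t -> conv u (midpoint x y) -> (x \in u) && (y \in u).
Proof.
move=> it ut xt yt; have [tw ->] := comb_midpoint xt yt.
move=> /convP[w' uw' e].
have E := indep_uniq it (fsubset_refl t) ut tw uw' e.
case: uw' => _ un _.
have h (b c : bool) : 2^-1 * (b%:R + c%:R) = 0 :> R -> ~~ b && ~~ c.
  by case: b c => [] [] //= h; exfalso; move: h; lra.
apply/andP; split; apply: contraT => /un; rewrite -E => /h.
  by rewrite eqxx.
by rewrite eqxx andbF.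
Qed.

End Convexity.

(** * The ten weights of a subdivided tetrahedron *)

Section TenWeights.
Variable R : realType.

(** The arguments are the weights at the four vertices and at the six midpoints. The first four
    cases are the corners. The last one covers the octahedron pieces, which contain the diagonal
    from [ab] to [cd], one of [ac], [bd] and one of [ad], [bc]. *)
Definition subdivision_support (wa wb wc wd ab ac ad bc bd cd : R) : Prop :=
  ([/\ wb = 0, wc = 0, wd = 0 & [/\ bc = 0, bd = 0 & cd = 0]] \/
   [/\ wa = 0, wc = 0, wd = 0 & [/\ ac = 0, ad = 0 & cd = 0]]) \/
  ([/\ wa = 0, wb = 0, wd = 0 & [/\ ab = 0, ad = 0 & bd = 0]] \/
   [/\ wa = 0, wb = 0, wc = 0 & [/\ ab = 0, ac = 0 & bc = 0]]) \/
  [/\ wa = 0, wb = 0, wc = 0 & [/\ wd = 0, ac = 0 \/ bd = 0 & ad = 0 \/ bc = 0]].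

(** In the corner at [a] the weights [wa], [ab], [ac], [ad] sum to 1, so the second argument of the
    maximum is [wa] itself. In any other piece [wa] is 0 and [ab + ac + ad] is at most 1. *)
Lemma support_corner_weights (wa wb wc wd ab ac ad bc bd cd : R) :
  0 <= wa -> 0 <= wb -> 0 <= wc -> 0 <= wd ->
  0 <= ab -> 0 <= ac -> 0 <= ad -> 0 <= bc -> 0 <= bd -> 0 <= cd ->
  wa + wb + wc + wd + ab + ac + ad + bc + bd + cd = 1 ->
  subdivision_support wa wb wc wd ab ac ad bc bd cd ->
  [/\ wa = Num.max 0 (2 * wa + ab + ac + ad - 1),
      wb = Num.max 0 (2 * wb + ab + bc + bd - 1),
      wc = Num.max 0 (2 * wc + ac + bc + cd - 1)
    & wd = Num.max 0 (2 * wd + ad + bd + cd - 1)].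
Proof.
move=> ? ? ? ? ? ? ? ? ? ? ? supp.
have mx (x y : R) : x = 0 /\ y <= 0 \/ x = y /\ 0 <= x -> x = Num.max 0 y.
  by case=> [[-> /max_l ->]|[<- /max_r ->]].
case: supp => [[|]|[[|]|]] [? ? ? [? ? ?]]; split; apply: mx;
  first [by left; split; lra | by right; split; lra].
Qed.

(** The midpoints of opposite edges are antipodal in the octahedron, and only the antipodal pair
    [ab], [cd] occurs in a common piece. *)
Lemma support_opposite (wa wb wc wd ab ac ad bc bd cd : R) :
  subdivision_support wa wb wc wd ab ac ad bc bd cd ->
  (ac = 0 \/ bd = 0) /\ (ad = 0 \/ bc = 0).
Proof.
by case=> [[|]|[[|]|]] [? ? ? [? ? ?]]; split; by [left|right|].
Qed.

(* Two solutions of the four equations differ by the same amount y at ac and at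
   bd; when y > 0 both ac and bd are positive. *)
Lemma opposite_uniq (ab ac ad bc bd cd ab' ac' ad' bc' bd' cd' : R) :
  0 <= ac -> 0 <= bd -> 0 <= ac' -> 0 <= bd' ->
  ac = 0 \/ bd = 0 -> ac' = 0 \/ bd' = 0 ->
  ab + ac + ad = ab' + ac' + ad' -> ab + bc + bd = ab' + bc' + bd' ->
  ac + bc + cd = ac' + bc' + cd' -> ad + bd + cd = ad' + bd' + cd' -> ac = ac'.
Proof.
move=> ac0 bd0 ac0' bd0' O O' e1 e2 e3 e4.
have {e1 e2 e3 e4} : ac - ac' = bd - bd' by lra.
by case: O => ->; case: O' => ->; lra.
Qed.

(* The corner weights are [max 0 (2 alpha - 1)] in the barycentric coordinates
   alpha of the point; the others are then determined by their sums at the four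
   vertices up to a two-dimensional ambiguity, which is removed by the vanishing
   of one weight in each of two opposite pairs. *)
Lemma support_uniq (wa wb wc wd ab ac ad bc bd cd : R)
   (wa' wb' wc' wd' ab' ac' ad' bc' bd' cd' : R) :
  0 <= wa -> 0 <= wb -> 0 <= wc -> 0 <= wd ->
  0 <= ab -> 0 <= ac -> 0 <= ad -> 0 <= bc -> 0 <= bd -> 0 <= cd ->
  wa + wb + wc + wd + ab + ac + ad + bc + bd + cd = 1 ->
  subdivision_support wa wb wc wd ab ac ad bc bd cd ->
  0 <= wa' -> 0 <= wb' -> 0 <= wc' -> 0 <= wd' ->
  0 <= ab' -> 0 <= ac' -> 0 <= ad' -> 0 <= bc' -> 0 <= bd' -> 0 <= cd' ->
  wa' + wb' + wc' + wd' + ab' + ac' + ad' + bc' + bd' + cd' = 1 ->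
  subdivision_support wa' wb' wc' wd' ab' ac' ad' bc' bd' cd' ->
  2 * wa + ab + ac + ad = 2 * wa' + ab' + ac' + ad' ->
  2 * wb + ab + bc + bd = 2 * wb' + ab' + bc' + bd' ->
  2 * wc + ac + bc + cd = 2 * wc' + ac' + bc' + cd' ->
  2 * wd + ad + bd + cd = 2 * wd' + ad' + bd' + cd' ->
  [/\ wa = wa', wb = wb', wc = wc' & wd = wd'] /\
  [/\ ab = ab', ac = ac', ad = ad' & [/\ bc = bc', bd = bd' & cd = cd']].
Proof.
move=> a0 b0 c0 d0 ab0 ac0 ad0 bc0 bd0 cd0 S1 S.
move=> a0' b0' c0' d0' ab0' ac0' ad0' bc0' bd0' cd0' S1' S' ea eb ec ed.
have [ha hb hc hd] :=
  support_corner_weights a0 b0 c0 d0 ab0 ac0 ad0 bc0 bd0 cd0 S1 S.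
have [ha' hb' hc' hd'] :=
  support_corner_weights a0' b0' c0' d0' ab0' ac0' ad0' bc0' bd0' cd0' S1' S'.
have ea' : wa = wa' by rewrite ha ea -ha'.
have eb' : wb = wb' by rewrite hb eb -hb'.
have ec' : wc = wc' by rewrite hc ec -hc'.
have ed' : wd = wd' by rewrite hd ed -hd'.
have [O1 O2] := support_opposite S; have [O1' O2'] := support_opposite S'.
have fa : ab + ac + ad = ab' + ac' + ad'.
  by apply: (addrI (2 * wa)); rewrite {2}ea' !addrA.
have fb : ab + bc + bd = ab' + bc' + bd'.
  by apply: (addrI (2 * wb)); rewrite {2}eb' !addrA.
have fc : ac + bc + cd = ac' + bc' + cd'.
  by apply: (addrI (2 * wc)); rewrite {2}ec' !addrA.
have fd : ad + bd + cd = ad' + bd' + cd'.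
  by apply: (addrI (2 * wd)); rewrite {2}ed' !addrA.
have eac := opposite_uniq ac0 bd0 ac0' bd0' O1 O1' fa fb fc fd.
have ead : ad = ad'.
  (* Exchanging [c] and [d] turns the pair [ad], [bc] into the pair [ac], [bd]. *)
  apply: (@opposite_uniq ab ad ac bd bc cd ab' ad' ac' bd' bc' cd' ad0 bc0 ad0' bc0' O2 O2') => //.
    by rewrite addrAC fa addrAC.
  by rewrite addrAC fb addrAC.
subst ac' ad'.
have eab : ab = ab' by move: fa => /addIr/addIr.
subst ab'.
have ebb : bc + bd = bc' + bd' by apply: (addrI ab); rewrite !addrA.
move: fb fc fd; rewrite -!addrA => /addrI _ /addrI e2 /addrI e3.
have ebc : bc = bc' by lra.
by split; split=> //; split=> //; lra.
Qed.

(** The homogeneous counterpart of [support_uniq] within a single piece. It is applied to affine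
    dependencies, whose coefficients may have any sign. *)
Lemma support_uniq0 (wa wb wc wd ab ac ad bc bd cd : R) :
  subdivision_support wa wb wc wd ab ac ad bc bd cd ->
  2 * wa + ab + ac + ad = 0 -> 2 * wb + ab + bc + bd = 0 ->
  2 * wc + ac + bc + cd = 0 -> 2 * wd + ad + bd + cd = 0 ->
  [/\ wa = 0, wb = 0, wc = 0 & wd = 0] /\
  [/\ ab = 0, ac = 0, ad = 0 & [/\ bc = 0, bd = 0 & cd = 0]].
Proof.
move=> S e1 e2 e3 e4; have [O1 O2] := support_opposite S.
have [za zb zc zd] : [/\ wa = 0, wb = 0, wc = 0 & wd = 0].
  by case: S => [[|]|[[|]|]] [? ? ? [? ? ?]]; split; lra.
have eac : ac = 0 by case: O1 => ?; lra.
have ead : ad = 0 by case: O2 => ?; lra.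
by split; split=> //; first lra; split; lra.
Qed.

Lemma support_exists (al be ga de : R) :
  0 <= al -> 0 <= be -> 0 <= ga -> 0 <= de -> al + be + ga + de = 1 ->
  [\/ 1 <= 2 * al, 1 <= 2 * be, 1 <= 2 * ga | 1 <= 2 * de] \/
  exists ab cd ac bd ad bc : R,
   [/\ (0 <= ab /\ 0 <= cd) /\ (0 <= ac /\ 0 <= bd) /\ (0 <= ad /\ 0 <= bc),
    (ac = 0 \/ bd = 0) /\ (ad = 0 \/ bc = 0),
    ab + cd + ac + bd + ad + bc = 1,
    (2 * al = ab + ac + ad) /\ (2 * be = ab + bc + bd)
    & (2 * ga = ac + bc + cd) /\ (2 * de = ad + bd + cd)].
Proof.
move=> a0 b0 c0 d0 S1.
have [?|ha] := lerP 1 (2 * al); first by left; constructor 1.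
have [?|hb] := lerP 1 (2 * be); first by left; constructor 2.
have [?|hc] := lerP 1 (2 * ga); first by left; constructor 3.
have [?|hd] := lerP 1 (2 * de); first by left; constructor 4.
right.
(* The equations force [u1 = ab - cd], [u2 = ac - bd] and [u3 = ad - bc]. The signs of [u2] and [u3]
   decide which weight of each of the last two pairs vanishes, and the total 1 then fixes [ab + cd].
   In each case one of [ab], [cd] is twice a coordinate and the other is 1 minus twice a coordinate,
   hence both are nonnegative. *)
set u1 := al + be - ga - de; set u2 := al + ga - be - de; set u3 := al + de - be - ga.
have [h2|h2] := lerP 0 u2; have [h3|h3] := lerP 0 u3.
- exists ((1 - u2 - u3 + u1) / 2), ((1 - u2 - u3 - u1) / 2), u2, 0, u3, 0.
  rewrite /u1 /u2 /u3 in h2 h3 *.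
  split; [by split; [|split]; split; lra| |lra|split; lra|split; lra].
  by split; right.
- exists ((1 - u2 + u3 + u1) / 2), ((1 - u2 + u3 - u1) / 2), u2, 0, 0, (- u3).
  rewrite /u1 /u2 /u3 in h2 h3 *.
  split; [by split; [|split]; split; lra| |lra|split; lra|split; lra].
  by split; [right|left].
- exists ((1 + u2 - u3 + u1) / 2), ((1 + u2 - u3 - u1) / 2), 0, (- u2), u3, 0.
  rewrite /u1 /u2 /u3 in h2 h3 *.
  split; [by split; [|split]; split; lra| |lra|split; lra|split; lra].
  by split; [left|right].
- exists ((1 + u2 + u3 + u1) / 2), ((1 + u2 + u3 - u1) / 2), 0, (- u2), 0, (- u3).
  rewrite /u1 /u2 /u3 in h2 h3 *.
  split; [by split; [|split]; split; lra| |lra|split; lra|split; lra].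
  by split; left.
Qed.

End TenWeights.

Lemma in_fset4 (T : choiceType) (x p q r s : T) :
  x \in [fset p; q; r; s] = [|| x == p, x == q, x == r | x == s].
Proof. by rewrite !inE -!orbA. Qed.

Lemma fset4_seq (T : choiceType) (p q r s : T) :
  uniq [:: p; q; r; s] -> perm_eq [fset p; q; r; s] [:: p; q; r; s].
Proof.
by move=> U; apply: uniq_perm; rewrite ?fset_uniq // => x; rewrite !inE !orbA.
Qed.

Lemma card_fset4 (T : choiceType) (p q r s : T) :
  (#|` [fset p; q; r; s]| == 4%N) = uniq [:: p; q; r; s].
Proof.
apply/eqP/idP => [e|/fset4_seq/perm_size //].
apply: (leq_size_uniq (fset_uniq [fset p; q; r; s])); last by rewrite e.
by move=> x; rewrite !inE -!orbA.
Qed.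

Lemma uniq4_neq (T : eqType) (p q r s : T) : uniq [:: p; q; r; s] ->
  [/\ p != q, p != r, p != s & [/\ q != r, q != s & r != s]].
Proof.
by rewrite /= !inE !negb_or !andbT => /and3P[/and3P[-> -> ->] /andP[-> ->] ->].
Qed.

Ltac rw_neqs := repeat match goal with
  | H : is_true (?x != ?y) |- context [?x == ?y] => rewrite (negPf H)
  | H : is_true (?y != ?x) |- context [?x == ?y] => rewrite (eq_sym x y) (negPf H)
  end.

Ltac split_ands := repeat match goal with
  | H : _ /\ _ |- _ => destruct H
  | H : and3 _ _ _ |- _ => destruct H
  | H : and4 _ _ _ _ |- _ => destruct H
  | H : and5 _ _ _ _ _ |- _ => destruct H
  end.

(** * The subdivision of a tetrahedron with labelled vertices *)

Section Labelled.
Variables (R : realType) (a b c d : 'rV[R]_3).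
Local Notation t := [fset a; b; c; d].
Local Notation ab := (midpoint a b).
Local Notation ac := (midpoint a c).
Local Notation ad := (midpoint a d).
Local Notation bc := (midpoint b c).
Local Notation bd := (midpoint b d).
Local Notation cd := (midpoint c d).
Hypothesis U : uniq [:: a; b; c; d].
Hypothesis indep : affinely_independent t.

Definition quad (al be ga de : R) : 'rV[R]_3 :=
  al *: a + be *: b + ga *: c + de *: d.

Lemma big_tet (V : nmodType) (F : 'rV[R]_3 -> V) :
  \sum_(v <- t) F v = F a + F b + F c + F d.
Proof. by rewrite (perm_big _ (fset4_seq U)) /= !big_cons big_nil addr0 !addrA. Qed.

Lemma quad0 al be ga de : al + be + ga + de = 0 -> quad al be ga de = 0 ->
  [/\ al = 0, be = 0, ga = 0 & de = 0].
Proof.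
move=> S0 Q0; move: (U); rewrite /= !inE !negb_or !andbT.
move=> /and3P[/and3P[N1 N2 N3] /andP[N4 N5] N6].
pose w v := if v == a then al else if v == b then be else if v == c then ga else de.
have [wa wb wc wd] : [/\ w a = al, w b = be, w c = ga & w d = de].
  by rewrite /w !eqxx; rw_neqs.
have h : {in t, forall v, w v = 0}.
  by apply: indep; rewrite big_tet wa wb wc wd.
by split; [rewrite -wa|rewrite -wb|rewrite -wc|rewrite -wd];
  apply: h; rewrite !inE eqxx ?orbT.
Qed.

Lemma quad_inj al be ga de al' be' ga' de' :
  al + be + ga + de = al' + be' + ga' + de' ->
  quad al be ga de = quad al' be' ga' de' ->
  [/\ al = al', be = be', ga = ga' & de = de'].
Proof.
move=> S Q.
have [||e1 e2 e3 e4] := @quad0 (al - al') (be - be') (ga - ga') (de - de').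
- lra.
- apply: (@addIr _ (quad al' be' ga' de')); rewrite add0r -[RHS]Q.
  by apply/rowP => i; rewrite !mxE; ring.
by split; lra.
Qed.

Definition subdivision_vertices := [:: a; b; c; d; ab; ac; ad; bc; bd; cd].

Lemma uniq_subdivision_vertices : uniq subdivision_vertices.
Proof.
(* [L] lists the doubled barycentric coordinates of the ten points. They are natural numbers of sum
   2, so that distinctness of the points becomes distinctness of these quadruples, which is decided
   by computation. *)
pose L : seq (nat * nat * nat * nat) := [:: (2, 0, 0, 0); (0, 2, 0, 0);
  (0, 0, 2, 0); (0, 0, 0, 2); (1, 1, 0, 0); (1, 0, 1, 0); (1, 0, 0, 1);
  (0, 1, 1, 0); (0, 1, 0, 1); (0, 0, 1, 1)]%N.
pose V (q : nat * nat * nat * nat) := let: (i, j, k, l) := q in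
  quad (i%:R / 2) (j%:R / 2) (k%:R / 2) (l%:R / 2).
have -> : subdivision_vertices = [seq V q | q <- L].
  by rewrite /subdivision_vertices /=; do !congr (_ :: _);
    apply/rowP => i; rewrite !mxE; field.
rewrite map_inj_in_uniq //.
have S q : q \in L -> let: (i, j, k, l) := q in (i + j + k + l = 2)%N.
  by rewrite !inE => /or4P[| | |/or4P[| | |/or4P[]]] /eqP ->.
move=> q q' /S + /S; case: q => [[[i j] k] l]; case: q' => [[[i' j'] k'] l'] e e'.
have n2 : (2^-1 : R) != 0 by rewrite invr_eq0 pnatr_eq0.
case/quad_inj; first by rewrite -!mulrDl -!natrD e e'.
move=> /(mulIf n2)/eqP e1 /(mulIf n2)/eqP e2 /(mulIf n2)/eqP e3 /(mulIf n2)/eqP e4.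
by move: e1 e2 e3 e4; rewrite !eqr_nat => /eqP -> /eqP -> /eqP -> /eqP ->.
Qed.

(** The order matters: [take 4] gives the corners and [drop 4] the octahedron pieces, and later
    proofs address single pieces by their position. *)
Definition pieces := [::
  [fset a; ab; ac; ad]; [fset b; ab; bc; bd];
  [fset c; ac; bc; cd]; [fset d; ad; bd; cd];
  [fset ab; cd; ac; ad]; [fset ab; cd; ac; bc];
  [fset ab; cd; bd; ad]; [fset ab; cd; bd; bc]].

Lemma subdivision_vertices_neq :
  ([/\ [/\ a != b, a != c & a != d], [/\ b != c, b != d & c != d],
   [/\ a != ab, a != ac & a != ad] & [/\ a != bc, a != bd & a != cd]] /\
  [/\ [/\ b != ab, b != ac & b != ad], [/\ b != bc, b != bd & b != cd],
   [/\ c != ab, c != ac & c != ad] & [/\ c != bc, c != bd & c != cd]]) /\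
  ([/\ [/\ d != ab, d != ac & d != ad], [/\ d != bc, d != bd & d != cd],
   [/\ ab != ac, ab != ad & ab != bc] & [/\ ab != bd, ab != cd & ac != ad]] /\
  [/\ [/\ ac != bc, ac != bd & ac != cd], [/\ ad != bc, ad != bd & ad != cd],
   bc != bd, bc != cd & bd != cd]).
Proof.
have := uniq_subdivision_vertices; rewrite /subdivision_vertices !cons_uniq !inE !negb_or.
by rewrite -!andbA; do 45 ![case/andP => ?] => _; do 4 ?split.
Qed.

Lemma comb_subdivision (s : {fset 'rV[R]_3}) w :
  {subset s <= subdivision_vertices} -> (forall v, v \notin s -> w v = 0) ->
  comb s w = quad (2^-1 * (2 * w a + w ab + w ac + w ad))
    (2^-1 * (2 * w b + w ab + w bc + w bd))
    (2^-1 * (2 * w c + w ac + w bc + w cd))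
    (2^-1 * (2 * w d + w ad + w bd + w cd)).
Proof.
move=> sub w0; rewrite (comb_widen uniq_subdivision_vertices sub w0).
rewrite /subdivision_vertices !big_cons big_nil.
set x1 := w ab; set x2 := w ac; set x3 := w ad; set x4 := w bc; set x5 := w bd.
by set x6 := w cd; apply/rowP => i; rewrite !mxE; field.
Qed.

Lemma sum_subdivision (s : {fset 'rV[R]_3}) (w : 'rV[R]_3 -> R) :
  {subset s <= subdivision_vertices} -> (forall v, v \notin s -> w v = 0) ->
  \sum_(v <- s) w v =
  w a + w b + w c + w d + w ab + w ac + w ad + w bc + w bd + w cd.
Proof.
move=> sub w0; rewrite (big_fset_widen uniq_subdivision_vertices sub w0).
by rewrite /subdivision_vertices !big_cons big_nil addr0 !addrA.
Qed.

Lemma pieces_vertices u : u \in pieces -> {subset u <= subdivision_vertices}.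
Proof.
rewrite !inE => H v vu; move: vu; rewrite /subdivision_vertices.
by case/or4P: H => [| | |/orP[|/or4P[]]] /eqP ->; rewrite in_fset4;
  case/or4P => /eqP ->; rewrite !in_cons eqxx ?orbT.
Qed.

Lemma pieces_support u (s : {fset 'rV[R]_3}) (w : 'rV[R]_3 -> R) : u \in pieces ->
  (s `<=` u)%fset -> (forall v, v \notin s -> w v = 0) ->
  subdivision_support (w a) (w b) (w c) (w d)
    (w ab) (w ac) (w ad) (w bc) (w bd) (w cd).
Proof.
move=> up /fsubsetP su w0.
have {su}w0 v : v \notin u -> w v = 0 by move=> vu; apply: w0; apply: contra vu => /su.
have N := subdivision_vertices_neq; split_ands.
move: up; rewrite !inE; case/or4P => [| | |/orP[|/or4P[]]] /eqP ?; subst u.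
- by left; left; split; [| | |split]; apply: w0; rewrite in_fset4; rw_neqs.
- by left; right; split; [| | |split]; apply: w0; rewrite in_fset4; rw_neqs.
- by right; left; left; split; [| | |split]; apply: w0; rewrite in_fset4; rw_neqs.
- by right; left; right; split; [| | |split]; apply: w0; rewrite in_fset4; rw_neqs.
- right; right; split; [| | |split; [|right|right]];
    by apply: w0; rewrite in_fset4; rw_neqs.
- right; right; split; [| | |split; [|right|left]];
    by apply: w0; rewrite in_fset4; rw_neqs.
- right; right; split; [| | |split; [|left|right]];
    by apply: w0; rewrite in_fset4; rw_neqs.
- right; right; split; [| | |split; [|left|left]];
    by apply: w0; rewrite in_fset4; rw_neqs.
Qed.

Lemma eq_subdivision (s s' : {fset 'rV[R]_3}) (w w' : 'rV[R]_3 -> R) :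
  {subset s <= subdivision_vertices} -> (forall v, v \notin s -> w v = 0) ->
  {subset s' <= subdivision_vertices} -> (forall v, v \notin s' -> w' v = 0) ->
  [/\ w a = w' a, w b = w' b, w c = w' c & w d = w' d] /\
  [/\ w ab = w' ab, w ac = w' ac, w ad = w' ad
    & [/\ w bc = w' bc, w bd = w' bd & w cd = w' cd]] -> w =1 w'.
Proof.
move=> sub w0 sub' w0' [[? ? ? ?] [? ? ? [? ? ?]]] v.
have [|vn] := boolP (v \in subdivision_vertices); last first.
  by rewrite w0 ?w0' //; [move: vn; apply: contra => /sub'|move: vn; apply: contra => /sub].
by rewrite !inE => /or4P[| | |/or4P[| | |/or4P[]]] /eqP ->.
Qed.

Lemma pieces_uniq u u' (s s' : {fset 'rV[R]_3}) w w' :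
  u \in pieces -> u' \in pieces -> (s `<=` u)%fset -> (s' `<=` u')%fset ->
  weights s w -> weights s' w' -> comb s w = comb s' w' -> w =1 w'.
Proof.
move=> up up' su su' [w0 wn w1] [w0' wn' w1'].
have sub : {subset s <= subdivision_vertices}.
  by move=> v /(fsubsetP su); apply: pieces_vertices.
have sub' : {subset s' <= subdivision_vertices}.
  by move=> v /(fsubsetP su'); apply: pieces_vertices.
have S := pieces_support up su wn; have S' := pieces_support up' su' wn'.
rewrite !comb_subdivision //.
rewrite sum_subdivision // in w1; rewrite sum_subdivision // in w1'.
case/quad_inj; first by lra.
move=> e1 e2 e3 e4; apply: (eq_subdivision sub wn sub' wn').
by apply: (support_uniq _ _ _ _ _ _ _ _ _ _ w1 S _ _ _ _ _ _ _ _ _ _ w1' S') => //; lra.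
Qed.

Lemma pieces_indep u : u \in pieces -> affinely_independent u.
Proof.
move=> up w S0 Q0.
pose w' v := if v \in u then w v else 0.
have wn v : v \notin u -> w' v = 0 by rewrite /w' => /negPf ->.
have ww' : {in u, w =1 w'} by move=> v vu; rewrite /w' vu.
have sub := pieces_vertices up.
have S := pieces_support up (fsubset_refl u) wn.
have : quad (2^-1 * (2 * w' a + w' ab + w' ac + w' ad))
    (2^-1 * (2 * w' b + w' ab + w' bc + w' bd))
    (2^-1 * (2 * w' c + w' ac + w' bc + w' cd))
    (2^-1 * (2 * w' d + w' ad + w' bd + w' cd)) = 0.
  by rewrite -(comb_subdivision sub wn) -[RHS]Q0; apply: eq_big_seq => v /ww' ->.
have : w' a + w' b + w' c + w' d + w' ab + w' ac + w' ad + w' bc + w' bd + w' cd = 0.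
  by rewrite -(sum_subdivision sub wn) -[RHS]S0; apply: eq_big_seq => v /ww' ->.
move=> T0; case/quad0; first by lra.
move=> e1 e2 e3 e4 v vu; rewrite ww' //.
apply: (@eq_subdivision u fset0 w' (fun=> 0)) => //.
by apply: support_uniq0 => //; lra.
Qed.

Lemma pieces_card u : u \in pieces -> #|` u| = 4%N.
Proof.
have N := subdivision_vertices_neq; split_ands.
rewrite !inE; case/or4P => [| | |/orP[|/or4P[]]] /eqP ->;
  by apply/eqP; rewrite card_fset4 /= !inE; rw_neqs.
Qed.

Lemma conv4I p q r s (x1 x2 x3 x4 : R) : uniq [:: p; q; r; s] ->
  0 <= x1 -> 0 <= x2 -> 0 <= x3 -> 0 <= x4 -> x1 + x2 + x3 + x4 = 1 ->
  conv [fset p; q; r; s] (x1 *: p + x2 *: q + x3 *: r + x4 *: s).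
Proof.
move=> V p1 p2 p3 p4 S1.
pose w v := if v == p then x1 else if v == q then x2 else if v == r then x3 else x4.
have [N1 N2 N3] : [/\ w p = x1, w q = x2 & w r = x3 /\ w s = x4].
  move: (V); rewrite /= !inE !negb_or !andbT.
  move=> /and3P[/and3P[? ? ?] /andP[? ?] ?].
  by rewrite /w !eqxx; rw_neqs.
case: N3 => N3 N4; exists w; split.
- by move=> v _; rewrite /w; do 3 ?case: ifP.
- by rewrite (perm_big _ (fset4_seq V)) /= !big_cons big_nil addr0 !addrA N1 N2 N3 N4.
- by rewrite (perm_big _ (fset4_seq V)) /= !big_cons big_nil addr0 !addrA N1 N2 N3 N4.
Qed.

Lemma pieces_cover x : conv t x -> exists2 u, u \in pieces & conv u x.
Proof.
case=> w [w0 + ->]; rewrite !big_tet.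
have a0 : 0 <= w a by rewrite w0 // !inE eqxx.
have b0 : 0 <= w b by rewrite w0 // !inE eqxx ?orbT.
have c0 : 0 <= w c by rewrite w0 // !inE eqxx ?orbT.
have d0 : 0 <= w d by rewrite w0 // !inE eqxx ?orbT.
move: (w a) (w b) (w c) (w d) a0 b0 c0 d0 => al be ga de a0 b0 c0 d0 S1.
have pk i : (i < 8)%N -> nth fset0 pieces i \in pieces by move=> i8; exact: mem_nth.
have pc i : (i < 8)%N -> #|` nth fset0 pieces i| == 4%N.
  by move=> /pk/pieces_card ->.
have [|] := support_exists a0 b0 c0 d0 S1.
  case=> h.
  - exists [fset a; ab; ac; ad]; first exact: (pk 0%N).
    (* The corner at [a] is the image of the tetrahedron under the homothety of ratio 1/2 about [a],
       so the coordinates at the other three vertices double. *)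
    rewrite (_ : _ + _ = (2 * al - 1) *: a + (2 * be) *: ab + (2 * ga) *: ac + (2 * de) *: ad).
      by apply: conv4I; try lra; rewrite -card_fset4; exact: (pc 0%N).
    by rewrite (_ : al = 1 - be - ga - de); [apply/rowP => i; rewrite !mxE; field|lra].
  - exists [fset b; ab; bc; bd]; first exact: (pk 1%N).
    rewrite (_ : _ + _ = (2 * be - 1) *: b + (2 * al) *: ab + (2 * ga) *: bc + (2 * de) *: bd).
      by apply: conv4I; try lra; rewrite -card_fset4; exact: (pc 1%N).
    by rewrite (_ : be = 1 - al - ga - de); [apply/rowP => i; rewrite !mxE; field|lra].
  - exists [fset c; ac; bc; cd]; first exact: (pk 2%N).
    rewrite (_ : _ + _ = (2 * ga - 1) *: c + (2 * al) *: ac + (2 * be) *: bc + (2 * de) *: cd).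
      by apply: conv4I; try lra; rewrite -card_fset4; exact: (pc 2%N).
    by rewrite (_ : ga = 1 - al - be - de); [apply/rowP => i; rewrite !mxE; field|lra].
  - exists [fset d; ad; bd; cd]; first exact: (pk 3%N).
    rewrite (_ : _ + _ = (2 * de - 1) *: d + (2 * al) *: ad + (2 * be) *: bd + (2 * ga) *: cd).
      by apply: conv4I; try lra; rewrite -card_fset4; exact: (pc 3%N).
    by rewrite (_ : de = 1 - al - be - ga); [apply/rowP => i; rewrite !mxE; field|lra].
case=> wab [wcd [wac [wbd [wad [wbc [[[p1 p2] [[p3 p4] [p5 p6]]] [O1 O2] T1 [e1 e2] [e3 e4]]]]]]].
(* All six midpoints are kept here; the two vanishing weights then single out one of the four
   octahedron pieces. *)
have E : al *: a + be *: b + ga *: c + de *: d =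
    wab *: ab + wcd *: cd + wac *: ac + wad *: ad + (wbd *: bd + wbc *: bc).
  rewrite (_ : al = 2^-1 * (wab + wac + wad)); last by lra.
  rewrite (_ : be = 2^-1 * (wab + wbc + wbd)); last by lra.
  rewrite (_ : ga = 2^-1 * (wac + wbc + wcd)); last by lra.
  rewrite (_ : de = 2^-1 * (wad + wbd + wcd)); last by lra.
  by apply/rowP => i; rewrite !mxE; field.
rewrite E //.
case: O1 O2 => [z1|z1] [z2|z2]; rewrite ?z1 ?z2 !scale0r ?addr0 ?add0r ?addrA.
- exists [fset ab; cd; bd; bc]; first exact: (pk 7%N).
  by apply: conv4I; try lra; rewrite -card_fset4; exact: (pc 7%N).
- exists [fset ab; cd; bd; ad]; first exact: (pk 6%N).
  rewrite -[_ + wbd *: bd]addrA [_ *: ad + _]addrC addrA.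
  by apply: conv4I; try lra; rewrite -card_fset4; exact: (pc 6%N).
- exists [fset ab; cd; ac; bc]; first exact: (pk 5%N).
  by apply: conv4I; try lra; rewrite -card_fset4; exact: (pc 5%N).
- exists [fset ab; cd; ac; ad]; first exact: (pk 4%N).
  by apply: conv4I; try lra; rewrite -card_fset4; exact: (pc 4%N).
Qed.

End Labelled.

(** * The pieces and the quadrilaterals *)

Section Pieces.
Variable R : realType.
Implicit Types (a b c d v p q r : 'rV[R]_3) (t u : {fset 'rV[R]_3}).

(** The opposite pair left out is [ad], [bc]. In this form [square a b c d] and [square a b d c]
    visibly share the diagonal from the midpoint of [ab] to that of [cd]. *)
Definition square a b c d : {fset 'rV[R]_3} :=
  [fset midpoint a b; midpoint c d; midpoint a c; midpoint b d].

Lemma squareC a b c d : square a b c d = square a c b d.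
Proof.
by apply/fsetP => x; rewrite !in_fset4; do 4 case: (x == _).
Qed.

Lemma corner_set v p q r : uniq [:: v; p; q; r] ->
  v |` [fset midpoint v w | w in [fset v; p; q; r] `\ v] =
  [fset v; midpoint v p; midpoint v q; midpoint v r].
Proof.
rewrite /= !inE !negb_or !andbT => /and3P[/and3P[N1 N2 N3] _ _].
have -> : [fset v; p; q; r] `\ v = [fset p; q; r].
  apply/fsetP => x; rewrite !inE; have [->|//] := eqVneq x v.
  by rw_neqs.
by rewrite !imfsetU !imfset_fset1 !fsetUA.
Qed.

Lemma cornerP a b c d u : uniq [:: a; b; c; d] ->
  corner [fset a; b; c; d] u <-> u \in take 4 (pieces a b c d).
Proof.
move=> U; have [N1 N2 N3 [N4 N5 N6]] := uniq4_neq U.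
have Ub : uniq [:: b; a; c; d] by rewrite /= !inE; rw_neqs.
have Uc : uniq [:: c; a; b; d] by rewrite /= !inE; rw_neqs.
have Ud : uniq [:: d; a; b; c] by rewrite /= !inE; rw_neqs.
have eb : [fset a; b; c; d] = [fset b; a; c; d].
  by apply/fsetP => x; rewrite !in_fset4; do 4 case: (x == _).
have ec : [fset a; b; c; d] = [fset c; a; b; d].
  by apply/fsetP => x; rewrite !in_fset4; do 4 case: (x == _).
have ed : [fset a; b; c; d] = [fset d; a; b; c].
  by apply/fsetP => x; rewrite !in_fset4; do 4 case: (x == _).
have Ea := corner_set U.
have Eb := corner_set Ub; rewrite -eb (midpointC b a) in Eb.
have Ec := corner_set Uc; rewrite -ec (midpointC c a) (midpointC c b) in Ec.
have Ed := corner_set Ud.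
rewrite -ed (midpointC d a) (midpointC d b) (midpointC d c) in Ed.
split.
  have m i := @mem_nth _ fset0 (take 4 (pieces a b c d)) i.
  case=> v vt ->; rewrite in_fset4 in vt; case/or4P: vt => /eqP ?; subst v;
  rewrite ?Ea ?Eb ?Ec ?Ed.
  - exact: (m 0).
  - exact: (m 1).
  - exact: (m 2).
  - exact: (m 3).
rewrite !inE => /or4P[] /eqP ->.
- by exists a; rewrite ?Ea // in_fset4 eqxx.
- by exists b; rewrite ?Eb // in_fset4 eqxx ?orbT.
- by exists c; rewrite ?Ec // in_fset4 eqxx ?orbT.
- by exists d; rewrite ?Ed // in_fset4 eqxx ?orbT.
Qed.

Lemma octahedron_pieceP a b c d u : uniq [:: a; b; c; d] ->
  affinely_independent [fset a; b; c; d] ->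
  octahedron_piece (square a b c d, square a b d c) u
    <-> u \in drop 4 (pieces a b c d).
Proof.
move=> U I; have N := subdivision_vertices_neq U I; split_ands.
rewrite /octahedron_piece /square /= (midpointC d c).
set ab := midpoint a b; set ac := midpoint a c; set ad := midpoint a d.
set bc := midpoint b c; set bd := midpoint b d; set cd := midpoint c d.
rewrite -/ab -/ac -/ad -/bc -/bd -/cd in H12 H13 H14 H15 *.
have -> : [fset ab; cd; ac; bd] `&` [fset ab; cd; ad; bc] = [fset ab; cd].
  apply/fsetP => x; rewrite ?(in_fsetI, in_fsetD, in_fset4, in_fset2).
  have [->|_] := eqVneq x ab; first by [].
  have [->|_] /= := eqVneq x cd; first by rewrite ?orbT.
  have [->|_] /= := eqVneq x ac; first by rw_neqs.
  by have [->|_] := eqVneq x bd; rewrite ?andbF //; rw_neqs.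
have -> : [fset ab; cd; ac; bd] `\` [fset ab; cd; ad; bc] = [fset ac; bd].
  apply/fsetP => x; rewrite ?(in_fsetI, in_fsetD, in_fset4, in_fset2).
  have [->|_] /= := eqVneq x ab; first by rw_neqs.
  have [->|_] /= := eqVneq x cd; first by rw_neqs.
  have [->|_] /= := eqVneq x ac; first by rw_neqs.
  by have [->|_] := eqVneq x bd; rewrite ?andbF //; rw_neqs.
have -> : [fset ab; cd; ad; bc] `\` [fset ab; cd; ac; bd] = [fset ad; bc].
  apply/fsetP => x; rewrite ?(in_fsetI, in_fsetD, in_fset4, in_fset2).
  have [->|_] /= := eqVneq x ab; first by rw_neqs.
  have [->|_] /= := eqVneq x cd; first by rw_neqs.
  have [->|_] /= := eqVneq x ad; first by rw_neqs.
  by have [->|_] := eqVneq x bc; rewrite ?andbF //; rw_neqs.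
split.
  case=> x [y [xQ yQ ->]]; rewrite !inE in xQ yQ.
  have m i := @mem_nth _ fset0 (drop 4 (pieces a b c d)) i.
  case/orP: xQ => /eqP ->; case/orP: yQ => /eqP ->; rewrite fsetUA.
  - exact: (m 0).
  - exact: (m 1).
  - exact: (m 2).
  - exact: (m 3).
by rewrite !inE => /or4P[] /eqP ->; [exists ac, ad|exists ac, bc|exists bd, ad|exists bd, bc];
  rewrite !inE !eqxx ?orbT fsetUA.
Qed.

End Pieces.

Section Quadrilaterals.
Variable R : realType.
Implicit Types (a b c d v p q r : 'rV[R]_3) (t u : {fset 'rV[R]_3}).

(** A quadrilateral depends only on the pair of opposite edges that it avoids, and a tetrahedron has
    three such pairs. *)
Lemma quadrilateralE a b c d (q : {fset 'rV[R]_3}) : uniq [:: a; b; c; d] ->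
  quadrilateral [fset a; b; c; d] q ->
  [\/ q = square a b c d, q = square a b d c | q = square a c d b].
Proof.
move=> U [a' [b' [c' [d' [e eq]]]]].
have {}eq : q = square a' c' d' b'.
  rewrite eq /square (midpointC d' b') (midpointC c' b').
  by apply/fsetP => x; rewrite !in_fset4; do 4 case: (x == _).
(* [s1] exchanges the ends of the avoided edge [xy], and [s3] exchanges the two avoided edges [xy]
   and [zw]. Together they bring [a] to the first place, which leaves the six orders of [b], [c],
   [d]. *)
have s1 x y z w : square x z w y = square y z w x.
  rewrite /square (midpointC w x) (midpointC z x) (midpointC w y) (midpointC z y).
  by apply/fsetP => v; rewrite !in_fset4; do 4 case: (v == _).
have s3 x y z w : square x z w y = square z x y w.
  rewrite /square (midpointC z x) (midpointC w y) (midpointC y w).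
  by apply/fsetP => v; rewrite !in_fset4; do 4 case: (v == _).
have [N1 N2 N3 [N4 N5 N6]] := uniq4_neq U.
have [b1 [c1 [d1 [{}eq {}e]]]] : exists b1 c1 d1, q = square a c1 d1 b1 /\
    [fset a; b; c; d] = [fset a; b1; c1; d1].
  have : a \in [fset a'; b'; c'; d'] by rewrite -e in_fset4 eqxx.
  rewrite in_fset4 => /or4P[] /eqP ?; subst a.
  - by exists b', c', d'.
  - exists a', c', d'; rewrite eq s1 e; split; first by [].
    by apply/fsetP => x; rewrite !in_fset4; do 4 case: (x == _).
  - exists d', a', b'; rewrite eq s3 e; split; first by [].
    by apply/fsetP => x; rewrite !in_fset4; do 4 case: (x == _).
  - exists c', a', b'; rewrite eq s3 s1 e; split; first by [].
    by apply/fsetP => x; rewrite !in_fset4; do 4 case: (x == _).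
have m x : x \in [fset a; b; c; d] -> x != a -> [|| x == b1, x == c1 | x == d1].
  by rewrite e in_fset4 => /orP[-> //|].
have {m} [mb mc md] : [/\ [|| b == b1, b == c1 | b == d1],
    [|| c == b1, c == c1 | c == d1] & [|| d == b1, d == c1 | d == d1]].
  by split; apply: m; rewrite ?in_fset4 ?eqxx ?orbT // eq_sym.
rewrite {q}eq.
case/or3P: mb => /eqP eb; case/or3P: mc => /eqP ec; case/or3P: md => /eqP ed;
  try by [rewrite eb ec eqxx in N4|rewrite eb ed eqxx in N5|rewrite ec ed eqxx in N6].
- by constructor 3; rewrite eb ec ed.
- by constructor 3; rewrite squareC eb ec ed.
- by constructor 2; rewrite eb ec ed.
- by constructor 1; rewrite eb ec ed.
- by constructor 2; rewrite squareC eb ec ed.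
- by constructor 1; rewrite squareC eb ec ed.
Qed.

End Quadrilaterals.

(** * The subdivision of one tetrahedron for an arbitrary admissible choice *)

Section Med.
Variable R : realType.
Implicit Types (a b c d x y z : 'rV[R]_3) (s t u w : {fset 'rV[R]_3}).

Lemma dotC x y : dot x y = dot y x.
Proof. by apply: eq_bigr => i _; rewrite mulrC. Qed.

Lemma edistC x y : edist x y = edist y x.
Proof.
rewrite /edist; congr Num.sqrt.
by apply: eq_bigr => i _; rewrite !mxE; ring.
Qed.

Lemma fset4_swap34 (T : choiceType) (p q r s : T) :
  [fset p; q; r; s] = [fset p; q; s; r].
Proof. by apply/fsetP => v; rewrite !in_fset4; do 4 case: (v == _). Qed.

Lemma fset4_swap23 (T : choiceType) (p q r s : T) :
  [fset p; q; r; s] = [fset p; r; q; s].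
Proof. by apply/fsetP => v; rewrite !in_fset4; do 4 case: (v == _). Qed.

Lemma fset4_rot3 (T : choiceType) (p q r s : T) :
  [fset p; q; r; s] = [fset p; r; s; q].
Proof. by rewrite fset4_swap23 fset4_swap34. Qed.

Lemma fset4_swap24 (T : choiceType) (p q r s : T) :
  [fset p; q; r; s] = [fset p; s; r; q].
Proof. by rewrite fset4_swap34 fset4_swap23 fset4_swap34. Qed.

Lemma almost_regular_swap34 t a b c d :
  almost_regular t a b c d -> almost_regular t a b d c.
Proof.
case=> tt et [l [eab [eac ead ebc ebd ecd]]]; split=> //.
  by rewrite et fset4_swap34.
by exists l; split=> //; split=> //; rewrite edistC.
Qed.

Definition labelled t (Q : {fset 'rV[R]_3} * {fset 'rV[R]_3}) a b c d : Prop :=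
  [/\ uniq [:: a; b; c; d], t = [fset a; b; c; d]
    & Q = (square a b c d, square a b d c)].

(** Only two of the three quadrilaterals contain the midpoint of the long edge [ab], so [Q] consists
    of these two; their order is absorbed by exchanging [c] and [d]. *)
Lemma labelled_almost_regular t Q a b c d :
  almost_regular t a b c d -> admissible t Q ->
  labelled t Q a b c d \/ labelled t Q a b d c.
Proof.
move=> ar [q1 q2 N /(_ _ _ _ _ ar)[m1 m2 _ _]].
have [tt et _] := ar; case: (tt) => ct it.
have U : uniq [:: a; b; c; d] by rewrite -card_fset4 -et ct.
rewrite et in q1 q2 it.
have ns : midpoint a b \notin square a c d b.
  have H := subdivision_vertices_neq U it; split_ands.
  by rewrite /square (midpointC d b) (midpointC c b) in_fset4; rw_neqs.
have {}q1 : Q.1 = square a b c d \/ Q.1 = square a b d c.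
  case: (quadrilateralE U q1) => e; [by left|by right|].
  by rewrite e (negPf ns) in m1.
have {}q2 : Q.2 = square a b c d \/ Q.2 = square a b d c.
  case: (quadrilateralE U q2) => e; [by left|by right|].
  by rewrite e (negPf ns) in m2.
have Ud : uniq [:: a; b; d; c] by rewrite -card_fset4 -fset4_swap34 -et ct.
have ed : t = [fset a; b; d; c] by rewrite -fset4_swap34.
case: Q N q1 q2 {m1 m2} => Q1 Q2 /= N [e1|e1] [e2|e2].
- by rewrite e1 e2 eqxx in N.
- by left; split=> //; rewrite e1 e2.
- by right; split=> //; rewrite e1 e2.
- by rewrite e1 e2 eqxx in N.
Qed.

(** For an almost regular [t] the labels come from its long edge. Otherwise they come from the
    diagonal common to the two quadrilaterals, with one labelling for each of the six ordered
    pairs. *)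
Lemma labelling t Q : tetrahedron t -> admissible t Q ->
  exists a b c d, labelled t Q a b c d /\
    forall a' b' c' d', almost_regular t a' b' c' d' -> almost_regular t a b c d.
Proof.
move=> tt ad; case: (pselect (exists a b c d, almost_regular t a b c d)).
  case=> a [b [c [d ar]]]; have [L|L] := labelled_almost_regular ar ad.
    by exists a, b, c, d.
  by exists a, b, d, c; split=> // *; exact: almost_regular_swap34.
move=> nar; case: tt => ct it; case: ad => q1 q2 N _.
have [a [b [c [d [et _]]]]] := q1.
suff [p [q [r [v L]]]] : exists p q r v, labelled t Q p q r v.
  by exists p, q, r, v; split=> // a' b' c' d' ar; case: nar; exists a', b', c', d'.
have U : uniq [:: a; b; c; d] by rewrite -card_fset4 -et ct.
have L p q r v : t = [fset p; q; r; v] -> Q = (square p q r v, square p q v r) ->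
    labelled t Q p q r v.
  by move=> e eQ; split=> //; rewrite -card_fset4 -e ct.
case: Q N q1 q2 L {nar} => Q1 Q2 /= N; rewrite et => q1 q2 L.
have := quadrilateralE U q2; have := quadrilateralE U q1.
case=> e1 [] e2; subst Q1 Q2; try by rewrite eqxx in N.
- by exists a, b, c, d; apply: L.
- by exists a, c, b, d; apply: L; rewrite ?(squareC a c b d) // fset4_swap23.
- by exists a, b, d, c; apply: L; rewrite // fset4_swap34.
- by exists a, d, b, c; apply: L; rewrite ?(squareC a d b c) ?(squareC a d c b) //
    fset4_swap34 fset4_swap23.
- by exists a, c, d, b; apply: L; rewrite ?(squareC a c b d) // fset4_rot3.
- by exists a, d, c, b; apply: L; rewrite ?(squareC a d b c) ?(squareC a d c b) // fset4_swap24.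
Qed.

Definition piece t (Q : {fset 'rV[R]_3} * {fset 'rV[R]_3}) u : Prop :=
  corner t u \/ octahedron_piece Q u.

Lemma labelled_pieceE t Q a b c d u : affinely_independent t ->
  labelled t Q a b c d -> piece t Q u <-> u \in pieces a b c d.
Proof.
move=> it [U et ->]; rewrite et in it *.
rewrite -[pieces a b c d](cat_take_drop 4) mem_cat.
by split=> [[/(cornerP _ U) ->//|/(octahedron_pieceP _ U it) ->]|
  /orP[/(cornerP _ U)|/(octahedron_pieceP _ U it)]]; rewrite ?orbT //; [left|right].
Qed.

Section Subdivision.
Variables (t : {fset 'rV[R]_3}) (Q : {fset 'rV[R]_3} * {fset 'rV[R]_3}).
Hypothesis tt : tetrahedron t.
Hypothesis adm : admissible t Q.

Lemma piece_labelling : exists a b c d, [/\ uniq [:: a; b; c; d],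
   t = [fset a; b; c; d], affinely_independent [fset a; b; c; d]
   & forall u, piece t Q u <-> u \in pieces a b c d].
Proof.
have [a [b [c [d [L _]]]]] := labelling tt adm.
have [U e _] := L; case: tt => _ it; exists a, b, c, d; split=> //.
  by rewrite -e.
by move=> u; exact: labelled_pieceE.
Qed.

Lemma piece_cap u u' s s' : piece t Q u -> piece t Q u' ->
  (s `<=` u)%fset -> (s' `<=` u')%fset ->
  (conv s `&` conv s')%classic = conv (s `&` s')%fset.
Proof.
have [a [b [c [d [U _ it P]]]]] := piece_labelling.
move=> /P pu /P pu' su su'; apply: conv_cap => w w'.
exact: (pieces_uniq U it pu pu').
Qed.

Lemma piece_indep u : piece t Q u -> affinely_independent u.
Proof.
have [a [b [c [d [U _ it P]]]]] := piece_labelling.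
by move=> /P; exact: (pieces_indep U it).
Qed.

Lemma piece_card u : piece t Q u -> #|` u| = 4%N.
Proof.
have [a [b [c [d [U _ it P]]]]] := piece_labelling.
by move=> /P; exact: (pieces_card U it).
Qed.

Lemma piece_cover x : conv t x -> exists2 u, piece t Q u & conv u x.
Proof.
have [a [b [c [d [U e it P]]]]] := piece_labelling.
by rewrite {1}e => /(pieces_cover U it)[u /P ? ?]; exists u.
Qed.

Lemma octahedron_vertex u z : octahedron_piece Q u -> z \in u ->
  exists x y, [/\ x \in t, y \in t, x != y & z = midpoint x y].
Proof.
have [a [b [c [d [[U e eQ] _]]]]] := labelling tt adm.
have it : affinely_independent t by case: tt.
have [N1 N2 N3 [N4 N5 N6]] := uniq4_neq U.
have [ta tb tc td] : [/\ a \in t, b \in t, c \in t & d \in t].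
  by rewrite e !in_fset4 !eqxx ?orbT.
rewrite eQ e in it * => /(octahedron_pieceP _ U it) pu zu; rewrite -e.
have : z \in [:: midpoint a b; midpoint a c; midpoint a d;
               midpoint b c; midpoint b d; midpoint c d].
  move: pu; rewrite !inE => /or4P[] /eqP eu; move: zu; rewrite eu in_fset4;
  by case/or4P => /eqP ->; rewrite eqxx ?orbT.
rewrite !inE => /or4P[| | |/or3P[]] /eqP ->.
- by exists a, b.
- by exists a, c.
- by exists a, d.
- by exists b, c.
- by exists b, d.
- by exists c, d.
Qed.

Lemma corner_vertex v u z : u = v |` [fset midpoint v x | x in t `\ v] ->
  v \in t -> z \in u -> exists2 x, x \in t & z = midpoint v x.
Proof.
move=> -> vt /fset1UP[->|]; first by exists v; rewrite ?midpointxx.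
by case/imfsetP => x /=; rewrite in_fsetD1 => /andP[_ xt] ->; exists x.
Qed.

Lemma piece_vertex u z : piece t Q u -> z \in u ->
  exists x y, [/\ x \in t, y \in t & z = midpoint x y].
Proof.
case=> [[v vt eu] zu|/octahedron_vertex + /[dup] zu]; last first.
  by move=> /[apply] -[x [y [? ? _ ->]]]; exists x, y.
by have [x xt ->] := corner_vertex eu vt zu; exists v, x.
Qed.

Lemma piece_conv u : piece t Q u -> {in u, forall v, conv t v}.
Proof.
move=> pu v vu; have [x [y [xt yt ->]]] := piece_vertex pu vu.
exact: midpoint_conv.
Qed.

(* It involves w only: for w with at most three vertices these are the simplices
   of the subdivision that any tetrahedron with the proper face w induces on w,
   whatever the choice of the quadrilaterals. *)
Definition face_subdivision w s : Prop :=
  (exists2 v, v \in w & (s `<=` v |` [fset midpoint v x | x in w `\ v])%fset) \/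
  {in s, forall z, exists x y, [/\ x \in w, y \in w, x != y & z = midpoint x y]}.

(** Every vertex of [s] is a midpoint of vertices of [t], and as it lies in the face [w], so do both
    ends. For a corner, nonemptiness of [s] thereby puts the apex [v] into [w]. *)
Lemma piece_face u s w : piece t Q u -> (s `<=` u)%fset -> s != fset0 ->
  (w `<=` t)%fset -> {in s, forall v, conv w v} -> face_subdivision w s.
Proof.
case: tt => _ it; case=> [[v vt eu]|oc] /fsubsetP su sn wt sw.
  have {su}sv z : z \in s -> exists x, [/\ x \in w, v \in w & z = midpoint v x].
    move=> zs; have [x xt ez] := corner_vertex eu vt (su _ zs).
    have := sw _ zs; rewrite ez => /(midpoint_face it wt vt xt)/andP[? ?].
    by exists x.
  left; exists v; first by have /fset0Pn[z /sv[x []]] := sn.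
  apply/fsubsetP => z /sv[x [xw vw ->]]; apply/fset1UP.
  have [->|xv] := eqVneq x v; first by left; rewrite midpointxx.
  by right; apply/imfsetP; exists x; rewrite //= in_fsetD1 xv.
right=> z zs; have [x [y [xt yt xy ez]]] := octahedron_vertex oc (su _ zs).
have := sw _ zs; rewrite ez => /(midpoint_face it wt xt yt)/andP[? ?].
by exists x, y.
Qed.

(** Corners of [w] extend to corners of [t]. For the midpoints of edges of [w], some vertex of [t]
    is missing from [w], and each facet of [t] has its three edge midpoints in one of the four
    octahedron pieces, so the piece of the facet opposite to the missing vertex contains [s]. *)
Lemma face_subdivision_piece w s : (w `<=` t)%fset -> w != t ->
  face_subdivision w s -> exists2 u, piece t Q u & (s `<=` u)%fset.
Proof.
move=> wt wn [[v vw sv]|sm].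
  exists (v |` [fset midpoint v x | x in t `\ v]).
    by left; exists v => //; exact: (fsubsetP wt).
  apply: fsubset_trans sv _; apply: fsetUS; apply/fsubsetP => z /imfsetP[x /= xw ->].
  apply/imfsetP; exists x => //=; move: xw; rewrite !in_fsetD1 => /andP[->].
  exact: (fsubsetP wt).
have [a [b [c [d [U e it P]]]]] := piece_labelling.
have [v vt vw] : exists2 v, v \in t & v \notin w.
  have : t `\` w != fset0.
    by apply: contraNneq wn => /eqP; rewrite fsetD_eq0 eqEfsubset wt.
  by case/fset0Pn => v; rewrite in_fsetD => /andP[vw vt]; exists v.
have m i : (i < 8)%N -> piece t Q (nth fset0 (pieces a b c d) i).
  by move=> i8; apply/P; exact: mem_nth.
have sub x : x \in w -> [&& x != v & [|| x == a, x == b, x == c | x == d]].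
  move=> xw; rewrite -in_fset4 -e (fsubsetP wt) // andbT.
  by apply: contraNneq vw => <-.
have [N1 N2 N3 [N4 N5 N6]] := uniq4_neq U.
rewrite e in_fset4 in vt; case/or4P: vt => /eqP ev.
- exists (nth fset0 (pieces a b c d) 7); first exact: m.
  apply/fsubsetP => z /sm[x [y [/sub + /sub + + ->]]]; rewrite ev /= in_fset4.
  case/andP => xa; rewrite (negPf xa) /= => /or3P[] /eqP ->;
  case/andP => ya; rewrite (negPf ya) /= => /or3P[] /eqP ->; rewrite ?eqxx //= => _;
  by rewrite ?(midpointC c b) ?(midpointC d b) ?(midpointC d c) ?eqxx ?orbT.
- exists (nth fset0 (pieces a b c d) 4); first exact: m.
  apply/fsubsetP => z /sm[x [y [/sub + /sub + + ->]]]; rewrite ev /= in_fset4.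
  case/andP => xa; rewrite (negPf xa) /= => /or3P[] /eqP ->;
  case/andP => ya; rewrite (negPf ya) /= => /or3P[] /eqP ->; rewrite ?eqxx //= => _;
  by rewrite ?(midpointC c a) ?(midpointC d a) ?(midpointC d c) ?eqxx ?orbT.
- exists (nth fset0 (pieces a b c d) 6); first exact: m.
  apply/fsubsetP => z /sm[x [y [/sub + /sub + + ->]]]; rewrite ev /= in_fset4.
  case/andP => xa; rewrite (negPf xa) /= => /or3P[] /eqP ->;
  case/andP => ya; rewrite (negPf ya) /= => /or3P[] /eqP ->; rewrite ?eqxx //= => _;
  by rewrite ?(midpointC b a) ?(midpointC d b) ?(midpointC d a) ?eqxx ?orbT.
- exists (nth fset0 (pieces a b c d) 5); first exact: m.
  apply/fsubsetP => z /sm[x [y [/sub + /sub + + ->]]]; rewrite ev /= in_fset4.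
  case/andP => xa; rewrite (negPf xa) ?orbF /= => /or3P[] /eqP ->;
  case/andP => ya; rewrite (negPf ya) ?orbF /= => /or3P[] /eqP ->; rewrite ?eqxx //= => _;
  by rewrite ?(midpointC c b) ?(midpointC b a) ?(midpointC c a) ?eqxx ?orbT.
Qed.

End Subdivision.
End Med.

(** * Gluing the subdivided tetrahedra *)

Section Gluing.
Variable R : realType.
Implicit Types (s t u : {fset 'rV[R]_3}) (K : complex R) (f : quad_choice R).

Lemma MedP f K s : Med f K s <->
  exists t u, [/\ K t, #|` t| = 4%N, piece t (f t) u, s != fset0 & (s `<=` u)%fset].
Proof.
split; first by case=> t [Kt ct] [u pu [sn su]]; exists t, u.
by case=> t [u [Kt ct pu sn su]]; exists t => //; exists u.
Qed.

(** [Med] reads only the tetrahedra of [K]. Purity ensures that they cover the whole underlying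
    space, and it lets properties of tetrahedra descend to all simplices. *)
Definition pure K : Prop :=
  forall s, K s -> exists t, [/\ K t, #|` t| = 4%N & (s `<=` t)%fset].

Lemma faces_triangulation t : tetrahedron t ->
  triangulation (conv t) (faces t) /\ pure (faces t).
Proof.
move=> [ct it]; have tn : t != fset0 by rewrite -cardfs_gt0 ct.
split; last by move=> s [_ st]; exists t; split=> //; split.
split; first split.
- by move=> s [sn st]; split=> //; exact: indep_sub it.
- by move=> s s' [_ st] s'n s's; split=> //; exact: fsubset_trans st.
- move=> s s' [_ st] [_ s't]; exists (s `&` s').
  split; rewrite ?fsubsetIl ?fsubsetIr //; apply: conv_cap => w w'.
  exact: (indep_uniq it).
- apply: sub_finite_set (finite_fset (fpowerset t)) => s [_ st] /=.
  by rewrite fpowersetE.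
- apply/seteqP; split=> x; first by case=> s [_ st]; exact: conv_sub.
  by move=> tx; exists t => //; split.
Qed.

Section MedComplex.
Variables (f : quad_choice R) (K : complex R) (A : set 'rV[R]_3).
Hypothesis adm : forall t, K t -> #|` t| = 4%N -> admissible t (f t).
Hypothesis triK : triangulation A K.
Hypothesis pureK : pure K.

Lemma complex_tetrahedron t : K t -> #|` t| = 4%N -> tetrahedron t.
Proof. by case: triK => -[I _ _] _ _ Kt ct; split=> //; case: (I t Kt). Qed.

(* Two simplices from distinct tetrahedra t, t' meet inside their common face,
   on which both tetrahedra induce the same subdivision. *)
Lemma Med_cap s s' : Med f K s -> Med f K s' ->
  exists u, [/\ (u `<=` s)%fset, (u `<=` s')%fset
    & (conv s `&` conv s')%classic = conv u].
Proof.
move=> /MedP[t [p [Kt ct pp sn sp]]] /MedP[t' [p' [Kt' ct' pp' sn' sp']]].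
have tt := complex_tetrahedron Kt ct; have tt' := complex_tetrahedron Kt' ct'.
have at_ := adm Kt ct; have at' := adm Kt' ct'.
have [e|tn] := eqVneq t t'.
  subst t'; exists (s `&` s'); rewrite fsubsetIl fsubsetIr; split=> //.
  exact: (piece_cap tt at_ pp pp').
case: triK => -[_ _ /(_ t t' Kt Kt')[w [wt wt' ew]]] _ _.
have wn : w != t.
  apply: contraNneq tn => e; rewrite e in wt'.
  by rewrite eqEfcard wt' ct ct'.
have wn' : w != t'.
  apply: contraNneq tn => e; rewrite e in wt.
  by rewrite eq_sym eqEfcard wt ct ct'.
have st : {in s, forall v, conv t v}.
  by move=> v vs; apply: (piece_conv tt at_ pp); exact: (fsubsetP sp).
have st' : {in s', forall v, conv t' v}.
  by move=> v vs; apply: (piece_conv tt' at' pp'); exact: (fsubsetP sp').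
(* By [conv_face] the intersection takes place between the parts [r] and [r'] of [s] and [s'] that
   lie in [w]. The part [r'], if nonempty, is also a face of a piece of [t], which reduces the claim
   to the pieces of one tetrahedron. *)
pose r := [fset v in s | `[< conv w v >]].
pose r' := [fset v in s' | `[< conv w v >]].
have rs : (r `<=` s)%fset by apply/fsubsetP => v; rewrite !inE => /andP[].
have rs' : (r' `<=` s')%fset by apply/fsubsetP => v; rewrite !inE => /andP[].
have rw : {in r, forall v, conv w v} by move=> v; rewrite !inE => /andP[_ /asboolP].
have rw' : {in r', forall v, conv w v} by move=> v; rewrite !inE => /andP[_ /asboolP].
exists (r `&` r'); split.
- exact: fsubset_trans (fsubsetIl _ _) rs.
- exact: fsubset_trans (fsubsetIr _ _) rs'.
have -> : (conv s `&` conv s')%classic = (conv r `&` conv r')%classic.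
  apply/seteqP; split=> x [h h']; last by split; [exact: conv_sub h|exact: conv_sub h'].
  have wx : conv w x by rewrite -ew; split; [exact: conv_conv h|exact: conv_conv h'].
  by split; [exact: conv_face tt.2 wt st h wx|exact: conv_face tt'.2 wt' st' h' wx].
have [r0'|rn'] := eqVneq r' fset0.
  rewrite r0' fsetI0; apply/seteqP; split=> x; [by case|by move=> /conv0].
have [u pu ru] : exists2 u, piece t (f t) u & (r' `<=` u)%fset.
  apply: (face_subdivision_piece tt at_ wt wn).
  exact: (piece_face tt' at' pp' (fsubset_trans rs' sp') rn' wt').
exact: (piece_cap tt at_ pp pu (fsubset_trans rs sp)).
Qed.

Lemma Med_triangulation : triangulation A (Med f K) /\ pure (Med f K).
Proof.
split; last first.
  move=> s /MedP[t [u [Kt ct pu sn su]]]; exists u.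
  have cu := piece_card (complex_tetrahedron Kt ct) (adm Kt ct) pu.
  split=> //; apply/MedP; exists t, u; split=> //.
  by rewrite -cardfs_gt0 cu.
split; first split.
- move=> s /MedP[t [u [Kt ct pu sn su]]]; split=> //; apply: indep_sub su _.
  exact: (piece_indep (complex_tetrahedron Kt ct) (adm Kt ct) pu).
- move=> s s' /MedP[t [u [Kt ct pu sn su]]] sn' ss'; apply/MedP; exists t, u.
  by split=> //; exact: fsubset_trans su.
- exact: Med_cap.
- pose N t := [fset midpoint x y | x in t, y in t].
  apply: (@sub_finite_set _ _ (\bigcup_(t in K) [set` fpowerset (N t)])%classic).
    move=> s /MedP[t [u [Kt ct pu sn su]]]; exists t => //=.
    rewrite fpowersetE; apply: fsubset_trans su _; apply/fsubsetP => z.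
    move=> /(piece_vertex (complex_tetrahedron Kt ct) (adm Kt ct) pu)[x [y [xt yt ->]]].
    exact: in_imfset2.
  by apply: bigcup_finite; [case: triK|move=> t _; exact: finite_fset].
- case: triK => _ _ <-; apply/seteqP; split=> x.
    case=> s /MedP[t [u [Kt ct pu sn su]]] sx; exists t => //.
    apply: conv_conv (conv_sub su sx).
    exact: (piece_conv (complex_tetrahedron Kt ct) (adm Kt ct) pu).
  case=> s /pureK[t [Kt ct st]] /(conv_sub st) tx.
  have tt := complex_tetrahedron Kt ct.
  have [u pu ux] := piece_cover tt (adm Kt ct) tx.
  exists u => //; apply/MedP; exists t, u; split=> //.
  by rewrite -cardfs_gt0 (piece_card tt (adm Kt ct) pu).
Qed.

End MedComplex.
End Gluing.

(** * Shapes of the pieces *)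

Section Shapes.
Variable R : realType.
Implicit Types (a b c d x y z v : 'rV[R]_3) (s t u : {fset 'rV[R]_3}).

Definition dotE := (big_ord_recl, big_ord0, mxE, addr0).

Lemma dot_ge0 x : 0 <= dot x x.
Proof. by apply: sumr_ge0 => i _; rewrite -expr2 sqr_ge0. Qed.

Lemma edist_ge0 x y : 0 <= edist x y.
Proof. exact: sqrtr_ge0. Qed.

Lemma edist_sqr x y : edist x y ^+ 2 = dot (x - y) (x - y).
Proof. by rewrite sqr_sqrtr // dot_ge0. Qed.

Lemma edistP x y l : 0 <= l -> dot (x - y) (x - y) = l ^+ 2 -> edist x y = l.
Proof. by move=> l0 e; rewrite /edist e sqrtr_sqr ger0_norm. Qed.

Lemma edist_gt0 x y : x != y -> 0 < edist x y.
Proof.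
move=> xy; rewrite sqrtr_gt0 lt_neqAle dot_ge0 andbT eq_sym.
apply: contraNneq xy => /eqP; rewrite psumr_eq0; last first.
  by move=> i _; rewrite -expr2 sqr_ge0.
move=> /allP h; rewrite -subr_eq0; apply/eqP/rowP => i; apply/eqP.
by have := h i (mem_index_enum i); rewrite /= -expr2 sqrf_eq0 [X in _ -> _ == X]mxE.
Qed.

Lemma edist_midpoint v x y : edist (midpoint v x) (midpoint v y) = edist x y / 2.
Proof.
apply: edistP; first by rewrite divr_ge0 ?edist_ge0 ?ler0n.
by rewrite expr_div_n edist_sqr /dot /midpoint !dotE; field.
Qed.

(** The bimedian formula. It measures the diagonal of the octahedron, the only edge of a piece that
    is not parallel to an edge of the tetrahedron. *)
Lemma dot_opposite a b c d :
  dot (midpoint a b - midpoint c d) (midpoint a b - midpoint c d) =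
  (edist a c ^+ 2 + edist a d ^+ 2 + edist b c ^+ 2 + edist b d ^+ 2
   - edist a b ^+ 2 - edist c d ^+ 2) / 4.
Proof. by rewrite !edist_sqr /dot /midpoint !dotE; field. Qed.

Definition quasi_regular t : Prop :=
  regular t \/ exists a b c d, almost_regular t a b c d.

Lemma quasi_regular_tetrahedron t : quasi_regular t -> tetrahedron t.
Proof. by case=> [[]|[a [b [c [d []]]]]]. Qed.

(** Since [midpoint v v = v], a corner is the image of [t] under a single homothety of ratio 1/2 and
    inherits the shape of [t]. *)
Lemma corner_image v t : v \in t ->
  v |` [fset midpoint v x | x in t `\ v] = [fset midpoint v x | x in t].
Proof.
move=> vt; apply/fsetP => z; apply/fset1UP/imfsetP => /= [[->|/imfsetP[x /=]]|[x xt ->]].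
- by exists v; rewrite // midpointxx.
- by rewrite in_fsetD1 => /andP[_ xt] ->; exists x.
have [->|xv] := eqVneq x v; first by left; rewrite midpointxx.
by right; apply/imfsetP; exists x; rewrite //= in_fsetD1 xv.
Qed.

Lemma corner_quasi_regular t u : tetrahedron u -> corner t u ->
  quasi_regular t -> quasi_regular u.
Proof.
move=> tu [v vt]; rewrite corner_image // => eu [[_ [l el]]|[a [b [c [d [_ et [l]]]]]]].
  left; split=> //; exists (l / 2) => x y; rewrite eu.
  move=> /imfsetP[x' /= xt ->] /imfsetP[y' /= yt ->] xy.
  by rewrite edist_midpoint el //; apply: contraNneq xy => ->.
case=> eab [eac ead ebc ebd ecd]; right.
exists (midpoint v a), (midpoint v b), (midpoint v c), (midpoint v d).
split=> //; first by rewrite eu et !imfsetU !imfset_fset1.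
by exists (l / 2); rewrite !edist_midpoint eab eac ead ebc ebd ecd mulrA.
Qed.

Lemma regular4 (p q r o : 'rV[R]_3) (l : R) : tetrahedron [fset p; q; r; o] ->
  edist p q = l -> edist p r = l -> edist p o = l ->
  edist q r = l -> edist q o = l -> edist r o = l -> regular [fset p; q; r; o].
Proof.
move=> tt e1 e2 e3 e4 e5 e6; split=> //; exists l => x y; rewrite !in_fset4.
by move=> /or4P[] /eqP -> /or4P[] /eqP -> //; rewrite ?eqxx // edistC.
Qed.

Lemma fset4_rot2 (T : choiceType) (p q r o : T) :
  [fset p; q; r; o] = [fset r; o; p; q].
Proof. by apply/fsetP => v; rewrite !in_fset4; do 4 case: (v == _). Qed.

(** The outer edges of the octahedron are midlines, half as long as the edges of [t] parallel to
    them. If [t] is regular of edge [l], the diagonal has length [Num.sqrt 2 * (l / 2)] and is the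
    long edge of all four pieces. If [t] has the long edge [ab], the diagonal has length [l / 2],
    and a long edge arises only from the two midlines parallel to [ab], which belong to one piece
    each. *)
Lemma octahedron_quasi_regular t (Q : {fset 'rV[R]_3} * {fset 'rV[R]_3}) u :
  tetrahedron u -> admissible t Q -> octahedron_piece Q u ->
  quasi_regular t -> quasi_regular u.
Proof.
move=> tu adm; have D a b c d : [/\
   [/\ edist (midpoint a b) (midpoint a c) = edist b c / 2,
       edist (midpoint a b) (midpoint a d) = edist b d / 2,
       edist (midpoint a b) (midpoint b c) = edist a c / 2
     & edist (midpoint a b) (midpoint b d) = edist a d / 2],
   [/\ edist (midpoint c d) (midpoint a c) = edist a d / 2,
       edist (midpoint c d) (midpoint a d) = edist a c / 2,
       edist (midpoint c d) (midpoint b c) = edist b d / 2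
     & edist (midpoint c d) (midpoint b d) = edist b c / 2]
 & [/\ edist (midpoint a c) (midpoint a d) = edist c d / 2,
       edist (midpoint a c) (midpoint b c) = edist a b / 2,
       edist (midpoint b d) (midpoint a d) = edist a b / 2
     & edist (midpoint b d) (midpoint b c) = edist c d / 2]].
  split; split; rewrite ?edist_midpoint //.
  - by rewrite midpointC edist_midpoint.
  - by rewrite midpointC edist_midpoint.
  - by rewrite (midpointC a c) edist_midpoint edistC.
  - by rewrite midpointC (midpointC a d) edist_midpoint edistC.
  - by rewrite (midpointC b c) edist_midpoint edistC.
  - by rewrite midpointC (midpointC b d) edist_midpoint edistC.
  - by rewrite (midpointC a c) (midpointC b c) edist_midpoint.
  - by rewrite (midpointC b d) (midpointC a d) edist_midpoint edistC.
  - by rewrite edistC.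
have s2 : Num.sqrt 2 ^+ 2 = 2 :> R by rewrite sqr_sqrtr.
move=> oc [rt|[a [b [c [d ar]]]]].
  have [tt [l el]] := rt; have [a [b [c [d [[U et eQ] _]]]]] := labelling tt adm.
  have it := tt.2; rewrite et in it.
  have [N1 N2 N3 [N4 N5 N6]] := uniq4_neq U.
  have [ta tb tc td] : [/\ a \in t, b \in t, c \in t & d \in t].
    by rewrite et !in_fset4 !eqxx ?orbT.
  have eo : edist (midpoint a b) (midpoint c d) = Num.sqrt 2 * (l / 2).
    apply: edistP; first by rewrite mulr_ge0 ?sqrtr_ge0 // -(el a b ta tb N1)
      divr_ge0 ?edist_ge0 // ler0n.
    by rewrite dot_opposite !el // exprMn s2; field.
  have [[D1 D2 D3 D4] [D5 D6 D7 D8] [D9 D10 D11 D12]] := D a b c d.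
  right; rewrite eQ in oc; move/(octahedron_pieceP _ U it): oc.
  rewrite !inE => /or4P[] /eqP eu.
  - exists (midpoint a b), (midpoint c d), (midpoint a c), (midpoint a d).
    by split=> //; exists (l / 2); rewrite eo D1 D2 D5 D6 D9 !el.
  - exists (midpoint a b), (midpoint c d), (midpoint a c), (midpoint b c).
    by split=> //; exists (l / 2); rewrite eo D1 D3 D5 D7 D10 !el.
  - exists (midpoint a b), (midpoint c d), (midpoint b d), (midpoint a d).
    by split=> //; exists (l / 2); rewrite eo D2 D4 D6 D8 D11 !el.
  - exists (midpoint a b), (midpoint c d), (midpoint b d), (midpoint b c).
    by split=> //; exists (l / 2); rewrite eo D3 D4 D7 D8 D12 !el.
wlog L : c d ar / labelled t Q a b c d.
  move=> H; case: (labelled_almost_regular ar adm) => L; first exact: (H c d ar L).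
  exact: (H d c (almost_regular_swap34 ar) L).
have [tt et [l [eab [eac ead ebc ebd ecd]]]] := ar.
have [U _ eQ] := L; have it := tt.2; rewrite et in it.
have eo : edist (midpoint a b) (midpoint c d) = l / 2.
  apply: edistP; first by rewrite -eac divr_ge0 ?edist_ge0 // ler0n.
  by rewrite dot_opposite eab eac ead ebc ebd ecd exprMn s2; field.
have [[D1 D2 D3 D4] [D5 D6 D7 D8] [D9 D10 D11 D12]] := D a b c d.
rewrite eab eac ead ebc ebd ecd in D1 D2 D3 D4 D5 D6 D7 D8 D9 D10 D11 D12.
rewrite eQ in oc; move/(octahedron_pieceP _ U it): oc.
rewrite !inE => /or4P[] /eqP eu.
- by left; move: tu; rewrite eu => tu; apply: (regular4 (l := l / 2)) tu _ _ _ _ _ _.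
- right; exists (midpoint a c), (midpoint b c), (midpoint a b), (midpoint c d).
  split=> //; first by rewrite eu fset4_rot2.
  exists (l / 2); rewrite D10 mulrA.
  by split=> //; split; rewrite // edistC.
- right; exists (midpoint b d), (midpoint a d), (midpoint a b), (midpoint c d).
  split=> //; first by rewrite eu fset4_rot2.
  exists (l / 2); rewrite D11 mulrA.
  by split=> //; split; rewrite // edistC.
- by left; move: tu; rewrite eu => tu; apply: (regular4 (l := l / 2)) tu _ _ _ _ _ _.
Qed.

Lemma piece_quasi_regular t Q u : admissible t Q -> piece t Q u ->
  quasi_regular t -> quasi_regular u.
Proof.
move=> adm pu qt; have tt := quasi_regular_tetrahedron qt.
have tu : tetrahedron u.
  by split; [exact: piece_card pu|exact: piece_indep pu].
case: pu => [cu|ou]; first exact: corner_quasi_regular cu qt.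
exact: octahedron_quasi_regular ou qt.
Qed.

Lemma Med_iter_triangulation (f : nat -> quad_choice R) t n :
  regular t -> (forall n, admissible_choice (f n)) ->
  [/\ triangulation (conv t) (Med_iter f n t), pure (Med_iter f n t)
    & forall s, Med_iter f n t s -> #|` s| = 4%N -> quasi_regular s].
Proof.
move=> rt adm; elim: n => [|n [T P S]] /=.
  have [T P] := faces_triangulation rt.1; split=> // s [_ st] cs; left.
  suff -> : s = t by [].
  by apply/eqP; rewrite eqEfcard st cs rt.1.1.
have A s : Med_iter f n t s -> #|` s| = 4%N -> admissible s (f n s).
  by move=> Ks cs; apply: adm; exact: S.
have [T' P'] := Med_triangulation A T P; split=> // s /MedP[s' [u [Ks cs pu _ su]]] c4.
have qs := S s' Ks cs.
suff -> : s = u by apply: piece_quasi_regular (A s' Ks cs) pu qs.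
apply/eqP; rewrite eqEfcard su c4.
by rewrite (piece_card (quasi_regular_tetrahedron qs) (A s' Ks cs) pu).
Qed.

End Shapes.

(** * Inscribed and circumscribed spheres *)

Section Fatness.
Variable R : realType.
Implicit Types (a b c d p q r u v x y z : 'rV[R]_3) (s t : {fset 'rV[R]_3}).

Lemma dotDl x y z : dot (x + y) z = dot x z + dot y z.
Proof. by rewrite /dot -big_split; apply: eq_bigr => i _; rewrite mxE mulrDl. Qed.

Lemma dotZl k x z : dot (k *: x) z = k * dot x z.
Proof. by rewrite /dot mulr_sumr; apply: eq_bigr => i _; rewrite mxE mulrA. Qed.

Lemma dot0l z : dot 0 z = 0.
Proof. by rewrite /dot big1 // => i _; rewrite mxE mul0r. Qed.

Lemma dot_suml s (F : 'rV[R]_3 -> 'rV[R]_3) z :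
  dot (\sum_(v <- s) F v) z = \sum_(v <- s) dot (F v) z.
Proof. by elim/big_rec2: _ => [|v x y _ <-]; rewrite ?dot0l ?dotDl. Qed.

(* The point h is where the sphere touches the facet opposite to v. *)
Lemma inscribedI s c rho : aff s c -> 0 < rho ->
  {in s, forall v, exists h, [/\ conv (s `\ v) h, edist c h = rho,
     {in s, forall u, u != v -> dot (u - h) (c - h) = 0} & 0 < dot (v - h) (c - h)]} ->
  inscribed_sphere s c rho.
Proof.
move=> sc rho0 H; split=> //; last first.
  by move=> v /H[h [vh eh _ _]]; exists h.
move=> x [w [w1 ex]] cx; exists w; split=> // v vs.
have [h [_ eh hu hv]] := H v vs.
(* The vertices other than [v] lie in the hyperplane through [h] with normal [c - h], so the weight
   of [x] at [v] has the sign of [dot (x - h) (c - h)]. *)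
rewrite -(pmulr_lge0 _ hv).
have <- : dot (x - h) (c - h) = w v * dot (v - h) (c - h).
  have -> : x - h = \sum_(u <- s) w u *: (u - h).
    under eq_bigr do rewrite scalerBr.
    by rewrite sumrB -scaler_suml w1 scale1r ex.
  rewrite dot_suml (big_fsetD1 v) //= dotZl big_seq big1 ?addr0 // => u.
  by rewrite in_fsetD1 => /andP[uv us]; rewrite dotZl hu // mulr0.
have e1 : dot (c - h) (c - h) = rho ^+ 2 by rewrite -edist_sqr eh.
have e2 : dot (c - x) (c - x) <= rho ^+ 2.
  by rewrite -edist_sqr ler_pXn2r // nnegrE ?edist_ge0 // ltW.
(* As [h] is on the sphere and [x] in the ball, expanding this square bounds [dot (x - c) (c - h)]
   below by [- rho ^+ 2]. *)
have e3 : 0 <= dot (x - c + (c - h)) (x - c + (c - h)).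
  exact: dot_ge0.
by move: e1 e2 e3; rewrite /dot !dotE; lra.
Qed.

(** Weights built from indicators let the three points coincide, so combinations of two points are
    covered by repeating one of them with coefficient 0. *)
Lemma conv3I s p q r (k1 k2 k3 : R) : p \in s -> q \in s -> r \in s ->
  0 <= k1 -> 0 <= k2 -> 0 <= k3 -> k1 + k2 + k3 = 1 ->
  conv s (k1 *: p + k2 *: q + k3 *: r).
Proof.
move=> ps qs rs k1p k2p k3p k1E.
exists (fun v => k1 * (v == p)%:R + k2 * (v == q)%:R + k3 * (v == r)%:R); split.
- by move=> v _; rewrite !addr_ge0 ?mulr_ge0 ?ler0n.
- by rewrite !big_split /= -!mulr_sumr !sum_indicator // !mulr1.
- under eq_bigr do rewrite !scalerDl -!scalerA.
  by rewrite !big_split /= -!scaler_sumr -!/(comb _ _) !comb_indicator.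
Qed.

(** Squared radii make the comparison free of outer roots. The ratios that occur are 1 for edges,
    1/2 and [Num.sqrt 2 - 1] for the triangles, 1/3 and [2 - Num.sqrt 3] for the tetrahedra; 1/4 is
    a rational bound below the least of them, [2 - Num.sqrt 3]. *)
Lemma fat_ratioI s c d (A B : R) : inscribed_sphere s c (Num.sqrt A) ->
  circumscribed_sphere s d (Num.sqrt B) -> 0 < B -> B <= 16 * A ->
  fat_ratio (1 / 4) s.
Proof.
move=> i ci B0 BA; exists c, (Num.sqrt A), d, (Num.sqrt B); split=> //.
rewrite ler_pdivlMr ?sqrtr_gt0 //.
have -> : 1 / 4 = Num.sqrt ((1 / 4) ^+ 2) :> R by rewrite sqrtr_sqr ger0_norm; lra.
rewrite -sqrtrM ?sqr_ge0 // ler_sqrt; lra.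
Qed.

Lemma edist_sqrt x y A : 0 <= A -> dot (x - y) (x - y) = A -> edist x y = Num.sqrt A.
Proof. by move=> A0 e; rewrite /edist e. Qed.

Lemma fat_ratio_edge p q : p != q -> fat_ratio (1 / 4) [fset p; q].
Proof.
move=> pq; pose L := dot (p - q) (p - q).
have L0 : 0 < L by rewrite /L -edist_sqr exprn_gt0 // edist_gt0.
have [ps qs] : p \in [fset p; q] /\ q \in [fset p; q] by rewrite !inE !eqxx orbT.
have e1 : edist (midpoint p q) p = Num.sqrt (L / 4).
  by apply: edist_sqrt; [lra|rewrite /L /midpoint /dot !dotE; field].
have e2 : edist (midpoint p q) q = Num.sqrt (L / 4).
  by apply: edist_sqrt; [lra|rewrite /L /midpoint /dot !dotE; field].
have m : aff [fset p; q] (midpoint p q) by apply/conv_aff/midpoint_conv.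
apply: (@fat_ratioI _ (midpoint p q) (midpoint p q) (L / 4) (L / 4)); try lra.
  apply: inscribedI => //; first by rewrite sqrtr_gt0; lra.
  move=> v; rewrite !inE => /orP[] /eqP ->.
  - exists q; split=> //.
    + by apply: conv_vertex; rewrite !inE eqxx eq_sym pq orbT.
    + move=> u; rewrite !inE => /orP[] /eqP ->; rewrite ?eqxx // => _.
      by rewrite subrr dot0l.
    + rewrite (_ : dot _ _ = L / 2); first by lra.
      by rewrite /L /midpoint /dot !dotE; field.
  - exists p; split=> //.
    + by apply: conv_vertex; rewrite !inE eqxx pq.
    + move=> u; rewrite !inE => /orP[] /eqP ->; rewrite ?eqxx // => _.
      by rewrite subrr dot0l.
    + rewrite (_ : dot _ _ = L / 2); first by lra.
      by rewrite /L /midpoint /dot !dotE; field.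
by split=> // v; rewrite !inE => /orP[] /eqP ->.
Qed.

Lemma in_fset3 (T : choiceType) (o e f g : T) :
  o \in [fset e; f; g] = [|| o == e, o == f | o == g].
Proof. by rewrite !inE -!orbA. Qed.

(** The equation says that the point [(k, k)] is as far from the line [x + y = 1] as from the axes.
    With rational bounds on its root, the later goals are polynomial. *)
Lemma right_isosceles_inradius :
  exists k : R, [/\ k ^+ 2 = 2 * k - 1 / 2, 2 / 7 <= k & k <= 1 / 3].
Proof.
have s2 : Num.sqrt 2 ^+ 2 = 2 :> R by rewrite sqr_sqrtr.
have s20 : 0 <= Num.sqrt 2 :> R by exact: sqrtr_ge0.
have s21 : 4 / 3 <= Num.sqrt 2 :> R by nra.
have s22 : Num.sqrt 2 <= 10 / 7 :> R by nra.
by exists (1 - Num.sqrt 2 / 2); split; lra.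
Qed.

(** The equation says that the point [(0, k, k)] is at distance [k] from the planes [x + y + z = 1]
    and [- x + y + z = 1]. The bound 4/15 is chosen to give [17 <= 64 * k], which the ratio 1/4
    requires. *)
Lemma almost_regular_inradius :
  exists k : R, [/\ k ^+ 2 = 4 * k - 1, 4 / 15 <= k & k <= 1 / 3].
Proof.
have s3 : Num.sqrt 3 ^+ 2 = 3 :> R by rewrite sqr_sqrtr.
have s30 : 0 <= Num.sqrt 3 :> R by exact: sqrtr_ge0.
have s31 : 5 / 3 <= Num.sqrt 3 :> R by nra.
have s32 : Num.sqrt 3 <= 26 / 15 :> R by nra.
by exists (2 - Num.sqrt 3); split; lra.
Qed.

(** * Simplices in an affine frame with a prescribed Gram matrix *)

Section Frame.
Variables (e X Y Z : 'rV[R]_3) (H K HZ KZ : R).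
Hypotheses (XX : dot X X = H) (YY : dot Y Y = H) (ZZ : dot Z Z = HZ).
Hypotheses (XY : dot X Y = K) (XZ : dot X Z = KZ) (YZ : dot Y Z = KZ).

Definition fr (k1 k2 k3 : R) : 'rV[R]_3 := e + k1 *: X + k2 *: Y + k3 *: Z.

Lemma dot_fr k1 k2 k3 l1 l2 l3 m1 m2 m3 n1 n2 n3 :
  dot (fr k1 k2 k3 - fr l1 l2 l3) (fr m1 m2 m3 - fr n1 n2 n3) =
  H * ((k1 - l1) * (m1 - n1) + (k2 - l2) * (m2 - n2))
  + HZ * ((k3 - l3) * (m3 - n3))
  + K * ((k1 - l1) * (m2 - n2) + (k2 - l2) * (m1 - n1))
  + KZ * ((k1 - l1 + (k2 - l2)) * (m3 - n3) + (k3 - l3) * (m1 - n1 + (m2 - n2))).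
Proof.
have D (x y z i j k : R) : fr x y z - fr i j k = (x - i) *: X + ((y - j) *: Y + (z - k) *: Z).
  by apply/rowP => o; rewrite !mxE; ring.
rewrite !D !(dotDl, dotZl) ![dot _ (_ + _)]dotC !(dotDl, dotZl).
by rewrite (dotC Y X) (dotC Z X) (dotC Z Y) XX YY ZZ XY XZ YZ; ring.
Qed.

Lemma conv_fr s (x y z i1 i2 i3 j1 j2 j3 k1 k2 k3 l1 l2 l3 : R) :
  fr i1 i2 i3 \in s -> fr j1 j2 j3 \in s -> fr k1 k2 k3 \in s ->
  0 <= l1 -> 0 <= l2 -> 0 <= l3 -> l1 + l2 + l3 = 1 ->
  x = l1 * i1 + l2 * j1 + l3 * k1 -> y = l1 * i2 + l2 * j2 + l3 * k2 ->
  z = l1 * i3 + l2 * j3 + l3 * k3 -> conv s (fr x y z).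
Proof.
move=> si sj sk l10 l20 l30 l1E -> -> ->.
rewrite (_ : fr _ _ _ = l1 *: fr i1 i2 i3 + l2 *: fr j1 j2 j3 + l3 *: fr k1 k2 k3).
  exact: conv3I.
by rewrite (_ : l1 = 1 - l2 - l3); [apply/rowP => o; rewrite !mxE; ring|lra].
Qed.

Lemma edist_fr k1 k2 k3 l1 l2 l3 A : 0 <= A ->
  H * ((k1 - l1) ^+ 2 + (k2 - l2) ^+ 2) + HZ * (k3 - l3) ^+ 2
  + 2 * (K * ((k1 - l1) * (k2 - l2)) + KZ * ((k1 - l1 + (k2 - l2)) * (k3 - l3))) = A ->
  edist (fr k1 k2 k3) (fr l1 l2 l3) = Num.sqrt A.
Proof. by move=> A0 <-; rewrite /edist dot_fr; congr Num.sqrt; ring. Qed.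

Section Triangle.
Local Notation p := (fr 0 0 0).
Local Notation q := (fr 1 0 0).
Local Notation r := (fr 0 1 0).
Hypotheses (pq : p != q) (pr : p != r) (qr : q != r).

Lemma fat_ratio_equilateral : 0 < H -> K = H / 2 -> fat_ratio (1 / 4) [fset p; q; r].
Proof.
move=> H0 KE; have H4 : 0 < H / 4 by lra.
have H12 : 0 <= H / 12 by lra.
have H3 : 0 <= H / 3 by lra.
have H12' : 0 < H / 12 by lra.
have H3' : 0 < H / 3 by lra.
have BA : H / 3 <= 16 * (H / 12) by lra.
set s := [fset p; q; r].
have [ps qs rs] : [/\ p \in s, q \in s & r \in s] by rewrite !in_fset3 !eqxx !orbT.
have D x v : x \in s -> x != v -> x \in s `\ v by rewrite in_fsetD1 => -> ->.
have D' x v : x \in s -> v != x -> x \in s `\ v by rewrite in_fsetD1 eq_sym => -> ->.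
have f7 : 0 <= 1 / 2 :> R by lra.
have f8 : 1 / 2 + 1 / 2 + 0 = 1 :> R by lra.
have sc : aff s (fr (1 / 3) (1 / 3) 0).
  by apply/conv_aff/(conv_fr (l1 := 1 / 3) (l2 := 1 / 3) (l3 := 1 / 3) ps qs rs); lra.
apply: (fat_ratioI (c := fr (1 / 3) (1 / 3) 0) (d := fr (1 / 3) (1 / 3) 0) _ _ H3' BA).
  apply: inscribedI => //; first by rewrite sqrtr_gt0.
  move=> v; rewrite in_fset3 => /or3P[] /eqP ->.
  - exists (fr (1 / 2) (1 / 2) 0); split.
    (* The facet has only two vertices; one of them is repeated with weight 0. *)
    + by apply: (conv_fr (D' _ _ qs pq) (D' _ _ rs pr) (D' _ _ rs pr) f7 f7 (lexx 0) f8); field.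
    + by apply: edist_fr => //; rewrite KE; field.
    + by move=> u; rewrite in_fset3 => /or3P[] /eqP ->; rewrite ?eqxx // => _;
        rewrite dot_fr KE; field.
    + by rewrite dot_fr KE (_ : _ + _ = H / 4) //; field.
  - exists (fr 0 (1 / 2) 0); split.
    + by apply: (conv_fr (D _ _ ps pq) (D' _ _ rs qr) (D' _ _ rs qr) f7 f7 (lexx 0) f8); field.
    + by apply: edist_fr => //; rewrite KE; field.
    + by move=> u; rewrite in_fset3 => /or3P[] /eqP ->; rewrite ?eqxx // => _;
        rewrite dot_fr KE; field.
    + by rewrite dot_fr KE (_ : _ + _ = H / 4) //; field.
  - exists (fr (1 / 2) 0 0); split.
    + by apply: (conv_fr (D _ _ ps pr) (D _ _ qs qr) (D _ _ qs qr) f7 f7 (lexx 0) f8); field.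
    + by apply: edist_fr => //; rewrite KE; field.
    + by move=> u; rewrite in_fset3 => /or3P[] /eqP ->; rewrite ?eqxx // => _;
        rewrite dot_fr KE; field.
    + by rewrite dot_fr KE (_ : _ + _ = H / 4) //; field.
by split=> // v; rewrite in_fset3 => /or3P[] /eqP ->; apply: edist_fr; rewrite // KE; field.
Qed.

(* The incentre lies on the bisector of the right angle, at the distance
   1 - sqrt 2 / 2 from the legs when these have length 1. *)
Lemma fat_ratio_right_isosceles : 0 < H -> K = 0 -> fat_ratio (1 / 4) [fset p; q; r].
Proof.
move=> H0 KE; set s := [fset p; q; r].
have [ps qs rs] : [/\ p \in s, q \in s & r \in s] by rewrite !in_fset3 !eqxx !orbT.
have D x v : x \in s -> x != v -> x \in s `\ v by rewrite in_fsetD1 => -> ->.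
have D' x v : x \in s -> v != x -> x \in s `\ v by rewrite in_fsetD1 eq_sym => -> ->.
have [k [kE k1 k2]] := right_isosceles_inradius.
have [f1 f2 f3 f4] : [/\ 0 <= 1 - 2 * k, 0 <= 1 - k, 0 <= k & 0 <= 1 / 2 - k].
  by split; lra.
have f5 : 1 - 2 * k + k + k = 1 by ring.
have f6 : 1 - k + k + 0 = 1 by ring.
have f7 : 0 <= 1 / 2 :> R by lra.
have f8 : 1 / 2 + 1 / 2 + 0 = 1 :> R by lra.
have [Hk3 Hk4 Hk5] : [/\ 0 < H * k ^+ 2, 0 < H * k & 0 < H * (1 / 2 - k)].
  by split; rewrite mulr_gt0 // ?exprn_gt0 //; lra.
have BA : H / 2 <= 16 * (H * k ^+ 2).
  by rewrite kE -subr_ge0 (_ : _ - _ = H * (32 * k - 17 / 2)); [rewrite mulr_ge0 ?ltW //; lra|field].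
have H2 : 0 < H / 2 by lra.
have sc : aff s (fr k k 0).
  by apply/conv_aff/(conv_fr ps qs rs f1 f3 f3 f5); ring.
have sd : aff s (fr (1 / 2) (1 / 2) 0).
  by apply/conv_aff/(conv_fr qs rs ps f7 f7 (lexx 0) f8); field.
apply: (fat_ratioI (c := fr k k 0) (d := fr (1 / 2) (1 / 2) 0) _ _ H2 BA).
  apply: inscribedI => //; first by rewrite sqrtr_gt0.
  move=> v; rewrite in_fset3 => /or3P[] /eqP ->.
  - exists (fr (1 / 2) (1 / 2) 0); split.
    + by apply: (conv_fr (D' _ _ qs pq) (D' _ _ rs pr) (D' _ _ rs pr) f7 f7 (lexx 0) f8); field.
    + apply: edist_fr; rewrite ?KE; first exact: ltW.
      apply/eqP; rewrite -subr_eq0 (_ : _ - _ = H * (k ^+ 2 - (2 * k - 1 / 2))); last by field.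
      by rewrite kE subrr mulr0.
    + by move=> u; rewrite in_fset3 => /or3P[] /eqP ->; rewrite ?eqxx // => _;
        rewrite dot_fr KE; field.
    + by rewrite dot_fr KE (_ : _ + _ = H * (1 / 2 - k)) //; field.
  - exists (fr 0 k 0); split.
    + by apply: (conv_fr (D _ _ ps pq) (D' _ _ rs qr) (D' _ _ rs qr) f2 f3 (lexx 0) f6); ring.
    + by apply: edist_fr; rewrite ?KE ?ltW //; ring.
    + by move=> u; rewrite in_fset3 => /or3P[] /eqP ->; rewrite ?eqxx // => _;
        rewrite dot_fr KE; ring.
    + by rewrite dot_fr KE (_ : _ + _ = H * k) //; ring.
  - exists (fr k 0 0); split.
    + by apply: (conv_fr (D _ _ ps pr) (D _ _ qs qr) (D _ _ qs qr) f2 f3 (lexx 0) f6); ring.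
    + by apply: edist_fr; rewrite ?KE ?ltW //; ring.
    + by move=> u; rewrite in_fset3 => /or3P[] /eqP ->; rewrite ?eqxx // => _;
        rewrite dot_fr KE; ring.
    + by rewrite dot_fr KE (_ : _ + _ = H * k) //; ring.
by split=> // v; rewrite in_fset3 => /or3P[] /eqP ->; apply: edist_fr; rewrite ?KE ?divr_ge0 ?ler0n ?ltW //; field.
Qed.

End Triangle.

(** The centroid is the centre of both spheres, and the inscribed one touches the facets at their
    centroids. *)
Lemma fat_ratio_regular_frame :
  uniq [:: fr 0 0 0; fr 1 0 0; fr 0 1 0; fr 0 0 1] ->
  0 < H -> HZ = H -> K = H / 2 -> KZ = H / 2 ->
  fat_ratio (1 / 4) [fset fr 0 0 0; fr 1 0 0; fr 0 1 0; fr 0 0 1].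
Proof.
move=> /uniq4_neq[N1 N2 N3 [N4 N5 N6]] H0 HZE KE KZE.
set s := [fset _; _; _; _].
have [ps qs rs os] : [/\ fr 0 0 0 \in s, fr 1 0 0 \in s, fr 0 1 0 \in s & fr 0 0 1 \in s].
  by rewrite !in_fset4 !eqxx !orbT.
have D x v : x \in s -> x != v -> x \in s `\ v by rewrite in_fsetD1 => -> ->.
have D' x v : x \in s -> v != x -> x \in s `\ v by rewrite in_fsetD1 eq_sym => -> ->.
have third : 0 <= 1 / 3 :> R by lra.
have third1 : 1 / 3 + 1 / 3 + 1 / 3 = 1 :> R by lra.
have H6 : 0 < H / 6 by lra.
have H24 : 0 <= H / 24 by lra.
have H38 : 0 <= 3 / 8 * H by lra.
have H24' : 0 < H / 24 by lra.
have H38' : 0 < 3 / 8 * H by lra.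
have BA : 3 / 8 * H <= 16 * (H / 24) by lra.
pose c := fr (1 / 4) (1 / 4) (1 / 4).
have cs : conv s c.
  apply: (@conv_conv _ [fset fr (1 / 3) (1 / 3) (1 / 3); fr 0 0 0]).
    move=> v; rewrite in_fset2 => /orP[] /eqP ->; last exact: conv_vertex.
    by apply: (conv_fr qs rs os third third third third1); field.
  rewrite (_ : c = (3 / 4) *: fr (1 / 3) (1 / 3) (1 / 3) + (1 / 4) *: fr 0 0 0 + 0 *: fr 0 0 0).
    by apply: conv3I; rewrite ?in_fset2 ?eqxx ?orbT //; lra.
  by apply/rowP => i; rewrite !mxE; field.
have sc := conv_aff cs.
apply: (fat_ratioI (c := c) (d := c) _ _ H38' BA).
  apply: inscribedI => //; first by rewrite sqrtr_gt0.
  move=> v; rewrite in_fset4 => /or4P[] /eqP ->.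
  - exists (fr (1 / 3) (1 / 3) (1 / 3)); split.
    + by apply: (conv_fr (D' _ _ qs N1) (D' _ _ rs N2) (D' _ _ os N3) third third third third1); field.
    + by apply: edist_fr => //; rewrite HZE KE KZE; field.
    + by move=> u; rewrite in_fset4 => /or4P[] /eqP ->; rewrite ?eqxx // => _;
        rewrite dot_fr HZE KE KZE; field.
    + by rewrite dot_fr HZE KE KZE (_ : _ + _ = H / 6) //; field.
  - exists (fr 0 (1 / 3) (1 / 3)); split.
    + by apply: (conv_fr (D _ _ ps N1) (D' _ _ rs N4) (D' _ _ os N5) third third third third1); field.
    + by apply: edist_fr => //; rewrite HZE KE KZE; field.
    + by move=> u; rewrite in_fset4 => /or4P[] /eqP ->; rewrite ?eqxx // => _;
        rewrite dot_fr HZE KE KZE; field.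
    + by rewrite dot_fr HZE KE KZE (_ : _ + _ = H / 6) //; field.
  - exists (fr (1 / 3) 0 (1 / 3)); split.
    + by apply: (conv_fr (D _ _ ps N2) (D _ _ qs N4) (D' _ _ os N6) third third third third1); field.
    + by apply: edist_fr => //; rewrite HZE KE KZE; field.
    + by move=> u; rewrite in_fset4 => /or4P[] /eqP ->; rewrite ?eqxx // => _;
        rewrite dot_fr HZE KE KZE; field.
    + by rewrite dot_fr HZE KE KZE (_ : _ + _ = H / 6) //; field.
  - exists (fr (1 / 3) (1 / 3) 0); split.
    + by apply: (conv_fr (D _ _ ps N3) (D _ _ qs N5) (D _ _ rs N6) third third third third1); field.
    + by apply: edist_fr => //; rewrite HZE KE KZE; field.
    + by move=> u; rewrite in_fset4 => /or4P[] /eqP ->; rewrite ?eqxx // => _;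
        rewrite dot_fr HZE KE KZE; field.
    + by rewrite dot_fr HZE KE KZE (_ : _ + _ = H / 6) //; field.
by split=> // v; rewrite in_fset4 => /or4P[] /eqP ->; apply: edist_fr; rewrite // HZE KE KZE; field.
Qed.

(* The incentre (0, r, r) lies at the distance r = 2 - sqrt 3 from the four
   facets, and the circumcentre is the midpoint of the long edge. *)
Lemma fat_ratio_almost_regular_frame :
  uniq [:: fr 1 0 0; fr (-1) 0 0; fr 0 1 0; fr 0 0 1] ->
  0 < H -> HZ = H -> K = 0 -> KZ = 0 ->
  fat_ratio (1 / 4) [fset fr 1 0 0; fr (-1) 0 0; fr 0 1 0; fr 0 0 1].
Proof.
move=> /uniq4_neq[N1 N2 N3 [N4 N5 N6]] H0 HZE KE KZE.
set s := [fset _; _; _; _].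
have [ps qs rs os] : [/\ fr 1 0 0 \in s, fr (-1) 0 0 \in s, fr 0 1 0 \in s & fr 0 0 1 \in s].
  by rewrite !in_fset4 !eqxx !orbT.
have D x v : x \in s -> x != v -> x \in s `\ v by rewrite in_fsetD1 => -> ->.
have D' x v : x \in s -> v != x -> x \in s `\ v by rewrite in_fsetD1 eq_sym => -> ->.
have [k [kE k1 k2]] := almost_regular_inradius.
(* The foot of the perpendicular from the incentre [(0, k, k)] to the plane [x + y + z = 1] is
   obtained by adding [m] to each coordinate; the facet in [- x + y + z = 1] is its mirror image. *)
pose m := (1 - 2 * k) / 3.
have m0 : 0 < m by rewrite /m; lra.
have k0 : 0 < k by lra.
have l0 := ltW m0; have l3 := ltW k0; have l1 := addr_ge0 l3 l0.
have l2 : 0 <= (1 - k) / 2 by lra.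
have l4 : 0 <= 1 - 2 * k by lra.
have h : 0 <= 1 / 2 :> R by lra.
have h1 : 1 / 2 + 1 / 2 + 0 = 1 :> R by lra.
have Hk3 : 0 < H * k ^+ 2 by rewrite mulr_gt0 // exprn_gt0.
have Hk : 0 < H * k by rewrite mulr_gt0.
have Hm : 0 < H * (2 * m) by apply: (mulr_gt0 H0); apply: mulr_gt0; rewrite ?ltr0n.
have BA : H <= 16 * (H * k ^+ 2).
  by rewrite kE -subr_ge0 (_ : _ - _ = H * (64 * k - 17)); [rewrite mulr_ge0 ?ltW //; lra|ring].
have lE : m + (k + m) + (k + m) = 1 by rewrite /m; field.
have lE' : (1 - k) / 2 + (1 - k) / 2 + k = 1 by field.
pose c := fr 0 k k.
have cs : conv s c.
  have ec : conv s (fr 0 0 0) by apply: (conv_fr ps qs qs h h (lexx 0) h1); field.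
  rewrite (_ : c = (1 - 2 * k) *: fr 0 0 0 + k *: fr 0 1 0 + k *: fr 0 0 1).
    apply: (@conv_conv _ [fset fr 0 0 0; fr 0 1 0; fr 0 0 1]).
      by move=> v; rewrite in_fset3 => /or3P[] /eqP ->; rewrite //; exact: conv_vertex.
    by apply: conv3I; rewrite ?in_fset3 ?eqxx ?orbT //; ring.
  by apply/rowP => i; rewrite !mxE; ring.
have sc := conv_aff cs.
have se : aff s (fr 0 0 0).
  by apply/conv_aff/(conv_fr ps qs qs h h (lexx 0) h1); field.
apply: (fat_ratioI (c := c) (d := fr 0 0 0) _ _ H0 BA).
  apply: inscribedI => //; first by rewrite sqrtr_gt0.
  move=> v; rewrite in_fset4 => /or4P[] /eqP ->.
  - exists (fr (- m) (k + m) (k + m)); split.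
    + by apply: (conv_fr (D' _ _ qs N1) (D' _ _ rs N2) (D' _ _ os N3) l0 l1 l1 lE); rewrite /m; field.
    + apply: edist_fr; rewrite ?HZE ?KE ?KZE /m; first exact: ltW.
      apply/eqP; rewrite -subr_eq0 (_ : _ - _ = H / 3 * (k ^+ 2 - (4 * k - 1))); last by field.
      by rewrite kE subrr mulr0.
    + by move=> u; rewrite in_fset4 => /or4P[] /eqP ->; rewrite ?eqxx // => _;
        rewrite dot_fr HZE KE KZE /m; field.
    + by rewrite dot_fr HZE KE KZE (_ : _ + _ = H * (2 * m)) // /m; field.
  - exists (fr m (k + m) (k + m)); split.
    + by apply: (conv_fr (D _ _ ps N1) (D' _ _ rs N4) (D' _ _ os N5) l0 l1 l1 lE); rewrite /m; field.
    + apply: edist_fr; rewrite ?HZE ?KE ?KZE /m; first exact: ltW.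
      apply/eqP; rewrite -subr_eq0 (_ : _ - _ = H / 3 * (k ^+ 2 - (4 * k - 1))); last by field.
      by rewrite kE subrr mulr0.
    + by move=> u; rewrite in_fset4 => /or4P[] /eqP ->; rewrite ?eqxx // => _;
        rewrite dot_fr HZE KE KZE /m; field.
    + by rewrite dot_fr HZE KE KZE (_ : _ + _ = H * (2 * m)) // /m; field.
  - exists (fr 0 0 k); split.
    + by apply: (conv_fr (D _ _ ps N2) (D _ _ qs N4) (D' _ _ os N6) l2 l2 l3 lE'); field.
    + apply: edist_fr; rewrite ?HZE ?KE ?KZE; first exact: ltW.
      by ring.
    + by move=> u; rewrite in_fset4 => /or4P[] /eqP ->; rewrite ?eqxx // => _;
        rewrite dot_fr HZE KE KZE; ring.
    + by rewrite dot_fr HZE KE KZE (_ : _ + _ = H * k) //; ring.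
  - exists (fr 0 k 0); split.
    + by apply: (conv_fr (D _ _ ps N3) (D _ _ qs N5) (D _ _ rs N6) l2 l2 l3 lE'); field.
    + apply: edist_fr; rewrite ?HZE ?KE ?KZE; first exact: ltW.
      by ring.
    + by move=> u; rewrite in_fset4 => /or4P[] /eqP ->; rewrite ?eqxx // => _;
        rewrite dot_fr HZE KE KZE; ring.
    + by rewrite dot_fr HZE KE KZE (_ : _ + _ = H * k) //; ring.
by split=> // v; rewrite in_fset4 => /or4P[] /eqP ->; apply: edist_fr; rewrite ?HZE ?KE ?KZE ?ltW //; ring.
Qed.

End Frame.
End Fatness.

(** * Fatness *)

Section FatSimplices.
Variable R : realType.
Implicit Types (a b c d p q r u v x y z : 'rV[R]_3) (s t : {fset 'rV[R]_3}).

Lemma dot_polar x y z : dot (y - x) (z - x) =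
  (edist y x ^+ 2 + edist z x ^+ 2 - edist y z ^+ 2) / 2.
Proof. by rewrite !edist_sqr /dot !dotE; field. Qed.

Lemma fat_ratio_equilateral_edist p q r (l : R) : 0 < l ->
  edist p q = l -> edist p r = l -> edist q r = l ->
  fat_ratio (1 / 4) [fset p; q; r].
Proof.
move=> l0 e1 e2 e3.
have ne x y : edist x y = l -> x != y.
  move=> e; apply: contraTneq l0 => xy.
  by rewrite -e xy /edist subrr dot0l sqrtr0 ltxx.
(* For a triangle the third frame vector is 0. *)
have d0 : dot (q - p) (0 : 'rV[R]_3) = 0 by rewrite dotC dot0l.
have d0' : dot (r - p) (0 : 'rV[R]_3) = 0 by rewrite dotC dot0l.
have h1 : dot (q - p) (q - p) = l ^+ 2 by rewrite -edist_sqr edistC e1.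
have h2 : dot (r - p) (r - p) = l ^+ 2 by rewrite -edist_sqr edistC e2.
have h3 : dot (q - p) (r - p) = l ^+ 2 / 2.
  by rewrite dot_polar edistC e1 edistC e2 e3; field.
have := @fat_ratio_equilateral _ p (q - p) (r - p) 0 _ _ _ _ h1 h2 (dot0l _) h3 d0 d0'.
have -> : fr p (q - p) (r - p) 0 0 0 0 = p by rewrite /fr !scale0r !addr0.
have -> : fr p (q - p) (r - p) 0 1 0 0 = q.
  by rewrite /fr !scale0r !addr0 scale1r addrC subrK.
have -> : fr p (q - p) (r - p) 0 0 1 0 = r.
  by rewrite /fr !scale0r !addr0 scale1r addrC subrK.
by apply; rewrite ?ne // exprn_gt0.
Qed.

Lemma fat_ratio_right_isosceles_edist p q r (l : R) : 0 < l ->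
  edist p q = l -> edist p r = l -> edist q r = Num.sqrt 2 * l ->
  fat_ratio (1 / 4) [fset p; q; r].
Proof.
move=> l0 e1 e2 e3.
have s2 : Num.sqrt 2 ^+ 2 = 2 :> R by rewrite sqr_sqrtr.
have ne x y : 0 < edist x y -> x != y.
  by apply: contraTneq => ->; rewrite /edist subrr dot0l sqrtr0 ltxx.
have d0 : dot (q - p) (0 : 'rV[R]_3) = 0 by rewrite dotC dot0l.
have d0' : dot (r - p) (0 : 'rV[R]_3) = 0 by rewrite dotC dot0l.
have h1 : dot (q - p) (q - p) = l ^+ 2 by rewrite -edist_sqr edistC e1.
have h2 : dot (r - p) (r - p) = l ^+ 2 by rewrite -edist_sqr edistC e2.
have h3 : dot (q - p) (r - p) = 0.
  by rewrite dot_polar edistC e1 edistC e2 e3 exprMn s2; field.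
have := @fat_ratio_right_isosceles _ p (q - p) (r - p) 0 _ _ _ _ h1 h2 (dot0l _) h3 d0 d0'.
have -> : fr p (q - p) (r - p) 0 0 0 0 = p by rewrite /fr !scale0r !addr0.
have -> : fr p (q - p) (r - p) 0 1 0 0 = q.
  by rewrite /fr !scale0r !addr0 scale1r addrC subrK.
have -> : fr p (q - p) (r - p) 0 0 1 0 = r.
  by rewrite /fr !scale0r !addr0 scale1r addrC subrK.
by apply; rewrite ?ne ?e1 ?e2 ?e3 ?mulr_gt0 ?sqrtr_gt0 ?exprn_gt0 ?ltr0n.
Qed.

Lemma fat_ratio_regular p q r v (l : R) : 0 < l -> uniq [:: p; q; r; v] ->
  edist p q = l -> edist p r = l -> edist p v = l ->
  edist q r = l -> edist q v = l -> edist r v = l ->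
  fat_ratio (1 / 4) [fset p; q; r; v].
Proof.
move=> l0 U e1 e2 e3 e4 e5 e6.
have hx x : edist p x = l -> dot (x - p) (x - p) = l ^+ 2.
  by move=> e; rewrite -edist_sqr edistC e.
have hy x y : edist p x = l -> edist p y = l -> edist x y = l ->
    dot (x - p) (y - p) = l ^+ 2 / 2.
  by move=> ex ey e; rewrite dot_polar edistC ex edistC ey e; field.
have := @fat_ratio_regular_frame _ p (q - p) (r - p) (v - p) _ _ _ _
  (hx _ e1) (hx _ e2) (hx _ e3) (hy _ _ e1 e2 e4) (hy _ _ e1 e3 e5) (hy _ _ e2 e3 e6).
have -> : fr p (q - p) (r - p) (v - p) 0 0 0 = p by rewrite /fr !scale0r !addr0.
have -> : fr p (q - p) (r - p) (v - p) 1 0 0 = q.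
  by rewrite /fr !scale0r !addr0 scale1r addrC subrK.
have -> : fr p (q - p) (r - p) (v - p) 0 1 0 = r.
  by rewrite /fr !scale0r !addr0 scale1r addrC subrK.
have -> : fr p (q - p) (r - p) (v - p) 0 0 1 = v.
  by rewrite /fr !scale0r !addr0 scale1r addrC subrK.
by apply; rewrite // exprn_gt0.
Qed.

(* The vectors from the midpoint of the long edge ab to a, c and d are orthogonal
   and of equal length. *)
Lemma fat_ratio_almost_regular a b c d (l : R) : 0 < l -> uniq [:: a; b; c; d] ->
  edist a b = Num.sqrt 2 * l -> edist a c = l -> edist a d = l ->
  edist b c = l -> edist b d = l -> edist c d = l ->
  fat_ratio (1 / 4) [fset a; b; c; d].
Proof.
move=> l0 U eab eac ead ebc ebd ecd.
have s2 : Num.sqrt 2 ^+ 2 = 2 :> R by rewrite sqr_sqrtr.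
have sq x y k : edist x y = k -> dot (x - y) (x - y) = k ^+ 2.
  by move=> <-; rewrite edist_sqr.
have hab : dot (a - b) (a - b) = 2 * l ^+ 2 by rewrite (sq _ _ _ eab) exprMn s2.
have hac := sq _ _ _ eac; have had := sq _ _ _ ead.
have hbc := sq _ _ _ ebc; have hbd := sq _ _ _ ebd; have hcd := sq _ _ _ ecd.
pose e := midpoint a b; pose X := 2^-1 *: (a - b).
have XX : dot X X = l ^+ 2 / 2.
  rewrite (_ : dot X X = dot (a - b) (a - b) / 4); first by rewrite hab; field.
  by rewrite /X /dot !dotE; field.
have YY y : dot (a - y) (a - y) = l ^+ 2 -> dot (b - y) (b - y) = l ^+ 2 ->
    dot (y - e) (y - e) = l ^+ 2 / 2.
  move=> h1 h2; rewrite (_ : dot _ _ = (2 * dot (a - y) (a - y)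
    + 2 * dot (b - y) (b - y) - dot (a - b) (a - b)) / 4).
    by rewrite hab h1 h2; field.
  by rewrite /e /midpoint /dot !dotE; field.
have XY y : dot (a - y) (a - y) = l ^+ 2 -> dot (b - y) (b - y) = l ^+ 2 ->
    dot X (y - e) = 0.
  move=> h1 h2; rewrite (_ : dot _ _ =
    (dot (b - y) (b - y) - dot (a - y) (a - y)) / 4).
    by rewrite h1 h2; field.
  by rewrite /X /e /midpoint /dot !dotE; field.
have YZ : dot (c - e) (d - e) = 0.
  have hc := YY c hac hbc; have hd := YY d had hbd.
  rewrite (_ : dot _ _ = (dot (c - e) (c - e) + dot (d - e) (d - e)
    - dot (c - d) (c - d)) / 2); first by rewrite hc hd hcd; field.
  by rewrite /dot !dotE; field.
have := @fat_ratio_almost_regular_frame _ e X (c - e) (d - e) _ _ _ _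
  XX (YY c hac hbc) (YY d had hbd) (XY c hac hbc) (XY d had hbd) YZ.
have -> : fr e X (c - e) (d - e) 1 0 0 = a.
  by rewrite /fr /e /X; apply/rowP => i; rewrite !mxE; field.
have -> : fr e X (c - e) (d - e) (-1) 0 0 = b.
  by rewrite /fr /e /X; apply/rowP => i; rewrite !mxE; field.
have -> : fr e X (c - e) (d - e) 0 1 0 = c.
  by rewrite /fr !scale0r !addr0 scale1r addrC subrK.
have -> : fr e X (c - e) (d - e) 0 0 1 = d.
  by rewrite /fr !scale0r !addr0 scale1r addrC subrK.
by apply; rewrite // divr_gt0 ?exprn_gt0 ?ltr0n.
Qed.

(* By the law of cosines, the angle at p has its cosine between 0 and 3/4. *)
Definition wide p q r : Prop :=
  let A := edist q p in let B := edist r p in let C := edist q r in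
  [/\ 0 < A, 0 < B, C ^+ 2 <= A ^+ 2 + B ^+ 2
    & 2 * (A ^+ 2 + B ^+ 2 - C ^+ 2) <= 3 * (A * B)].

(** The angles to be covered are pi/4, pi/3 and pi/2, and 3/4 is a rational bound for the largest of
    their cosines, that of pi/4. *)
Lemma wide_angle p q r : wide p q r -> acos (3 / 4) <= angle p q r.
Proof.
move=> [A0 B0 hC hA]; rewrite /angle dot_polar.
set A := edist q p in A0 hC hA *; set B := edist r p in B0 hC hA *.
set C := edist q r in hC hA *.
set k := _ / (A * B).
have AB : 0 < A * B by exact: mulr_gt0.
have k0 : 0 <= k.
  by apply: divr_ge0; [apply: divr_ge0; rewrite ?subr_ge0 ?ler0n|exact: ltW].
have k1 : k <= 3 / 4 by rewrite /k ler_pdivrMr //; lra.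
have rk : -1 <= k <= 1 by apply/andP; split; lra.
have r3 : -1 <= (3 / 4 : R) <= 1 by apply/andP; split; lra.
(* Since [cos] is strictly decreasing on [[0, pi]], a smaller angle would have its cosine above
   3/4. *)
rewrite leNgt; apply/negP => lt.
have : cos (acos (3 / 4 : R)) < cos (acos k).
  have I (x : R) : -1 <= x <= 1 -> acos x \in `[0, pi].
    by move=> hx; rewrite in_itv /= acos_ge0 ?acos_lepi.
  by rewrite ltr_cos ?I.
by rewrite acosK ?in_itv // acosK ?in_itv // ltNge k1.
Qed.

(* l is the length of the short edges of the tetrahedron. *)
Definition face_shape p q r (l : R) : Prop :=
  [\/ [/\ edist q p = l, edist r p = l & edist q r = l],
      [/\ edist q p = l, edist r p = l & edist q r = Num.sqrt 2 * l],
      [/\ edist q p = Num.sqrt 2 * l, edist r p = l & edist q r = l]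
    | [/\ edist q p = l, edist r p = Num.sqrt 2 * l & edist q r = l]].

Lemma face_shape_wide p q r (l : R) : 0 < l -> face_shape p q r l -> wide p q r.
Proof.
move=> l0.
have s2 : Num.sqrt 2 ^+ 2 = 2 :> R by rewrite sqr_sqrtr.
have s20 : 0 < Num.sqrt 2 :> R by rewrite sqrtr_gt0.
(* At an end of a long edge the last bound of [wide] reads
   [4 * l ^+ 2 <= 3 * (Num.sqrt 2 * l * l)]. *)
have s21 : 4 / 3 <= Num.sqrt 2 :> R by nra.
have ll : 0 < l ^+ 2 by exact: exprn_gt0.
have kl : 4 / 3 * l ^+ 2 <= Num.sqrt 2 * l * l.
  by rewrite -[leRHS]mulrA -expr2 ler_wpM2r // ltW.
have kl0 : 0 < Num.sqrt 2 * l by exact: mulr_gt0.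
by case=> [] [e1 e2 e3]; split; rewrite ?e1 ?e2 ?e3 ?exprMn ?s2 //; lra.
Qed.

Lemma face_shape_fat_ratio p q r (l : R) : 0 < l -> face_shape p q r l ->
  fat_ratio (1 / 4) [fset p; q; r].
Proof.
move=> l0 [] [e1 e2 e3].
- by apply: (fat_ratio_equilateral_edist l0); rewrite // edistC.
- by apply: (fat_ratio_right_isosceles_edist l0); rewrite // edistC.
- rewrite fsetUC fsetUA.
  by apply: (fat_ratio_right_isosceles_edist l0); rewrite // edistC.
- rewrite [X in X `|` _]fsetUC.
  by apply: (fat_ratio_right_isosceles_edist l0); rewrite // edistC.
Qed.

Lemma quasi_regular_face_shape t p q r : quasi_regular t ->
  p \in t -> q \in t -> r \in t -> p != q -> p != r -> q != r ->
  exists2 l : R, 0 < l & face_shape p q r l.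
Proof.
move=> [[_ [l el]]|[a [b [c [d [[ct _] et [l [eab [eac ead ebc ebd ecd]]]]]]]]].
  move=> pt qt rt pq pr qr; exists l; first by rewrite -(el p q) // edist_gt0.
  by constructor 1; rewrite !el // eq_sym.
have [_ _ _ [_ _ cd]] : [/\ a != b, a != c, a != d & [/\ b != c, b != d & c != d]].
  by apply: uniq4_neq; rewrite -card_fset4 -et ct.
move=> + + + pq pr qr; rewrite et !in_fset4 => pt qt rt.
exists l; first by rewrite -ecd edist_gt0.
case/or4P: pt => /eqP ?; subst p; case/or4P: qt => /eqP ?; subst q;
  rewrite ?eqxx // in pq; case/or4P: rt => /eqP ?; subst r;
  rewrite ?eqxx // in pr qr; rewrite /face_shape
  ?(edistC b a) ?(edistC c a) ?(edistC d a) ?(edistC c b) ?(edistC d b) ?(edistC d c)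
  ?eab ?eac ?ead ?ebc ?ebd ?ecd;
  by [constructor 1|constructor 2|constructor 3|constructor 4].
Qed.

Lemma card2 s : #|` s| = 2%N -> exists p q, s = [fset p; q] /\ p != q.
Proof.
have E x : (x \in s) = (x \in (s : seq _)) by [].
move: (fset_uniq s) E; case: (enum_fset s) => [|p [|q [|//]]] //=.
rewrite !inE !andbT => pq E _; exists p, q; split=> //; apply/fsetP => x.
by rewrite E !inE.
Qed.

Lemma card3 s : #|` s| = 3%N -> exists p q r,
  [/\ s = [fset p; q; r], p != q, p != r & q != r].
Proof.
have E x : (x \in s) = (x \in (s : seq _)) by [].
move: (fset_uniq s) E; case: (enum_fset s) => [|p [|q [|r [|//]]]] //=.
rewrite !inE !negb_or !andbT => /andP[/andP[pq pr] qr] E _.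
exists p, q, r; split=> //; apply/fsetP => x.
by rewrite E !inE -!orbA.
Qed.

Lemma card4 s : #|` s| = 4%N -> exists p q r v, s = [fset p; q; r; v].
Proof.
have E x : (x \in s) = (x \in (s : seq _)) by [].
move: E; case: (enum_fset s) => [|p [|q [|r [|v [|//]]]]] //= E _.
by exists p, q, r, v; apply/fsetP => x; rewrite E in_fset4 !inE.
Qed.

Lemma quasi_regular_fat_ratio t s : quasi_regular t -> (s `<=` t)%fset ->
  (1 < #|` s|)%N -> fat_ratio (1 / 4) s.
Proof.
move=> qt st s1; have [ct it] := quasi_regular_tetrahedron qt.
have := fsubset_leq_card st; rewrite ct leq_eqVlt => /orP[/eqP c4|].
  have {st} -> : s = t by apply/eqP; rewrite eqEfcard st c4 ct.
  case: qt => [[_ [l el]]|[a [b [c [d [_ et [l [eab [eac ead ebc ebd ecd]]]]]]]]].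
    have [a [b [c [d et]]]] : exists a b c d, t = [fset a; b; c; d] by exact: card4.
    have U : uniq [:: a; b; c; d] by rewrite -card_fset4 -et ct.
    have [N1 N2 N3 [N4 N5 N6]] := uniq4_neq U.
    have [ta tb tc td] : [/\ a \in t, b \in t, c \in t & d \in t].
      by rewrite et !in_fset4 !eqxx ?orbT.
    rewrite et; apply: (@fat_ratio_regular _ _ _ _ l); rewrite ?el //.
    by rewrite -(el a b) // edist_gt0.
  have U : uniq [:: a; b; c; d] by rewrite -card_fset4 -et ct.
  have [N1 N2 N3 [N4 N5 N6]] := uniq4_neq U.
  rewrite et; apply: (@fat_ratio_almost_regular _ _ _ _ l) => //.
  by rewrite -ecd edist_gt0.
rewrite ltnS leq_eqVlt => /orP[/eqP c3|].
  have [p [q [r [es pq pr qr]]]] := card3 c3.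
  have /fsubsetP sub := st; rewrite es in sub.
  have [pt rt qt'] : [/\ p \in t, r \in t & q \in t].
    by split; apply: sub; rewrite in_fset3 eqxx ?orbT.
  have [l l0 sh] := quasi_regular_face_shape qt pt qt' rt pq pr qr.
  by rewrite es; exact: face_shape_fat_ratio sh.
rewrite ltnS => s2; have c2 : #|` s| == 2%N by rewrite eqn_leq s2.
have [p [q [es pq]]] : exists p q, s = [fset p; q] /\ p != q by exact: card2 (eqP c2).
by rewrite es; exact: fat_ratio_edge.
Qed.

(** Halving [acos (3 / 4)] turns the weak bound on the angles into the strict one that [fat_angles]
    demands. *)
Lemma quasi_regular_fat t s : quasi_regular t -> (s `<=` t)%fset ->
  fat_simplex (Num.min (1 / 4) (acos (3 / 4) / 2)) s.
Proof.
move=> qt st; split=> [s1|c3 p q r es].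
  have [c [rin [d [Rout [i ci h]]]]] := quasi_regular_fat_ratio qt st s1.
  exists c, rin, d, Rout; split=> //; apply: le_trans h.
  by rewrite ge_min lexx.
have /fsubsetP sub := st; rewrite es in sub.
have [pt qt' rt] : [/\ p \in t, q \in t & r \in t].
  by split; apply: sub; rewrite in_fset3 eqxx ?orbT.
have [pq pr qr] : [/\ p != q, p != r & q != r].
  have : uniq [:: p; q; r].
    apply: (leq_size_uniq (fset_uniq s)); last by rewrite c3.
    by move=> x; rewrite es in_fset3 !inE.
  by rewrite /= !inE !negb_or !andbT => /andP[/andP[]].
have [l l0 sh] := quasi_regular_face_shape qt pt qt' rt pq pr qr.
apply: lt_le_trans (wide_angle (face_shape_wide l0 sh)).
have a0 : 0 < acos (3 / 4 : R) by apply: acos_gt0; apply/andP; split; lra.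
by rewrite gt_min; apply/orP; right; lra.
Qed.

End FatSimplices.

Unset Implicit Arguments.

Theorem lemma5p9 (R : realType) (tau : {fset 'rV[R]_3}) :
  regular tau ->
  exists phi : R, 0 < phi /\
    forall f : nat -> quad_choice R,
      (forall n : nat, admissible_choice (f n)) ->
      forall n : nat, (1 <= n)%N ->
        triangulation (conv tau) (Med_iter f n tau) /\
        fat phi (Med_iter f n tau).
Proof.
move=> rt; exists (Num.min (1 / 4) (acos (3 / 4) / 2)); split.
  have a0 : 0 < acos (3 / 4 : R) by apply: acos_gt0; apply/andP; split; lra.
  by rewrite lt_min; apply/andP; split; lra.
move=> f adm n _; have [T P S] := Med_iter_triangulation n rt adm.
split=> // s Ks; have [t [Kt ct st]] := P s Ks.
exact: quasi_regular_fat (S t Kt ct) st.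
Qed.
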